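(* Let $t\ge 3$ be an integer, $\varepsilon<1$ any constant, $C$ a sufficiently large constant, and $Cn^{-1/4}(\ln n)^{9/4}\le p<\varepsilon$. Then with high probability \[\tau_t(G_{n,p})=(t+o(1))\,\chi(G_{n,p}).\]
   Context: A (proper) $t$-tone $k$-coloring of a graph $G$ is a function $f:V(G)\to\binom{[k]}{t}$ such that $|f(u)\cap f(v)|<d(u,v)$ for all distinct vertices $u,v$ ($d$ = graph distance); $\tau_t(G)$ is the least $k$ for which such a coloring exists. $\chi$ is the ordinary chromatic number. $G_{n,p}$ is the Erdős–Rényi random graph on $[n]$; ''with high probability'' means with probability $\to1$ as $n\to\infty$. *)

(* Defs.v *)
From Stdlib Require Import Reals ClassicalEpsilon.
From mathcomp Require Import all_boot.

Set Implicit Arguments.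
Unset Strict Implicit.
Unset Printing Implicit Defensive.

(* A simple graph on [n] is encoded by its edge set S, a subset of the
   "upper" pairs {(i,j) | i < j}.  The sample space of G_{n,p} is the set of
   all such S. *)
Definition upairs (n : nat) : {set 'I_n * 'I_n} := [set e : 'I_n * 'I_n | (e.1 < e.2)%N].

Definition is_graph n (S : {set 'I_n * 'I_n}) : bool := S \subset upairs n.

Definition adj n (S : {set 'I_n * 'I_n}) (u v : 'I_n) : bool :=
  (u != v) && (((u, v) \in S) || ((v, u) \in S)).

(* within S m u v : there is a walk of length at most m from u to v,
   i.e. d(u,v) <= m (graph distance; d = infinity if not connected). *)
Fixpoint within n (S : {set 'I_n * 'I_n}) (m : nat) (u v : 'I_n) : bool :=
  match m with
  | 0 => u == v
  | m'.+1 => within S m' u v || [exists w, adj S u w && within S m' w v]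
  end.

(* k < d(u,v)  (with the convention d(u,v) = infinity for disconnected u,v) *)
Definition lt_dist n (S : {set 'I_n * 'I_n}) (k : nat) (u v : 'I_n) : bool :=
  ~~ within S k u v.

Definition colorable n (S : {set 'I_n * 'I_n}) (k : nat) : bool :=
  [exists f : {ffun 'I_n -> 'I_k},
     [forall u, forall v, adj S u v ==> (f u != f v)]].

Lemma colorable_ex n (S : {set 'I_n * 'I_n}) : exists k, colorable S k.
Proof.
exists n; apply/existsP; exists [ffun u => u].
apply/forallP => u; apply/forallP => v; apply/implyP => /andP[Huv _].
by rewrite !ffunE.
Qed.

Definition chi n (S : {set 'I_n * 'I_n}) : nat := ex_minn (colorable_ex S).

Definition tone_colorable n (S : {set 'I_n * 'I_n}) (t k : nat) : bool :=
  [exists f : {ffun 'I_n -> {set 'I_k}},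
     [forall v, #|f v| == t] &&
     [forall u, forall v, (u != v) ==> lt_dist S #|f u :&: f v| u v]].

Lemma tone_colorable_ex n (S : {set 'I_n * 'I_n}) (t : nat) :
  exists k, tone_colorable S t k.
Proof.
exists #|{: 'I_n * 'I_t}|; apply/existsP.
exists [ffun v => [set enum_rank (v, i) | i : 'I_t]].
apply/andP; split.
  apply/forallP => v; rewrite ffunE card_imset ?card_ord //.
  by move=> i j /enum_rank_inj [].
apply/forallP => u; apply/forallP => v; apply/implyP => Huv.
rewrite !ffunE.
suff -> : [set enum_rank (u, i) | i : 'I_t] :&: [set enum_rank (v, i) | i : 'I_t]
          = set0 by rewrite cards0 /lt_dist /= Huv.
apply/setP => x; rewrite !inE; apply/negP => /andP[/imsetP[i _ ->] /imsetP[j _]].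
by move/enum_rank_inj => [Hij _]; rewrite Hij eqxx in Huv.
Qed.

Definition tau n (t : nat) (S : {set 'I_n * 'I_n}) : nat :=
  ex_minn (tone_colorable_ex S t).

Local Open Scope R_scope.

Definition gnp_weight n (p : R) (S : {set 'I_n * 'I_n}) : R :=
  p ^ #|S| * (1 - p) ^ (#|upairs n| - #|S|).

Definition event_ind n (E : {set 'I_n * 'I_n} -> Prop) (S : {set 'I_n * 'I_n}) : bool :=
  if excluded_middle_informative (E S) then true else false.

Definition Pr_gnp n (p : R) (E : {set 'I_n * 'I_n} -> Prop) : R :=
  foldr (fun S acc => gnp_weight p S + acc) 0
        [seq S <- enum {: {set 'I_n * 'I_n}} | is_graph S && event_ind E S].

Definition whp (p : nat -> R) (E : forall n, {set 'I_n * 'I_n} -> Prop) : Prop :=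
  forall eta, 0 < eta -> exists N : nat, forall n : nat, (N <= n)%nat ->
    1 - eta <= Pr_gnp (p n) (E n).

(* Main.v *)
(* A colour class of a t-tone colouring is an independent set and every vertex lies in t of them,
   so t n <= alpha(G) tau_t(G), while alpha(G) <= (1+o(1)) 2 log_b(np), b = 1/(1-p), by the first
   moment.  Conversely, two non-adjacent vertices may share one colour, so it suffices to find t
   proper colourings with (1+o(1)) n / (2 log_b(np)) colours each, on disjoint palettes, such that
   no two vertices agree in two of them; the first of these colourings also bounds chi(G).
   They are built one after the other, greedily removing independent sets of size
   k = (1-o(1)) 2 log_b(np) that meet every class of the previous colourings at most once.  By
   Janson's inequality, for given previous colourings, a set of m = n / (ln n)^{3/2} vertices
   contains such a k-set except with probability exp(-c m^2 / k^4).  As p >= n^{-1/4} (ln n)^{9/4},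
   this beats the n^{tn} 2^n choices of the previous colourings and of the m-set.  Once fewer than
   m vertices are left, every subgraph has minimum degree O(pm), by Chernoff's bound, and
   O(pm) = o(np / ln n) further colours suffice. *)
From HB Require Import structures.
Require Import Defs.
From Stdlib Require Import Reals ZArith Lra Lia.
From mathcomp Require Import all_boot.

Set Implicit Arguments.
Unset Strict Implicit.
Unset Printing Implicit Defensive.

Local Open Scope R_scope.

(** * Expectation over a random subset *)

(** The earlier colourings depend on the graph, so they cannot be fixed before it is exposed; hence
    the union bound over all tuples of colourings, and this bound dictates the density. With [k] of
    order [ln n / p] and [m = n / (ln n)^(3/2)], Janson's exponent [m^2 / k^4] has order
    [n * (n p^4) / (ln n)^7]. The hypothesis says [n p^4 >= (ln n)^9], so the exponent has order at
    least [n (ln n)^2], against [t n ln n] for the logarithm of the number of choices; the spare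
    factor [ln n] absorbs the constants. The power 3/2 is a compromise: [m] must be [o(n / ln n)]
    for the leftover vertices to be cheap, but not much smaller for Janson's bound to win. The
    values [tau] and [t * chi] are never compared directly: [chi] and [tau / t] both lie between
    [n / a] and [N], where [a] bounds the independence number, [N] is the number of colours of one
    round, and [a N <= (1 + o(1)) n]. *)

Lemma RplusA : associative Rplus. Proof. by move=> x y z; lra. Qed.
Lemma RmultA : associative Rmult. Proof. by move=> x y z; lra. Qed.
Lemma RmultDl : left_distributive Rmult Rplus. Proof. by move=> x y z; lra. Qed.
Lemma RmultDr : right_distributive Rmult Rplus. Proof. by move=> x y z; lra. Qed.

HB.instance Definition _ := Monoid.isComLaw.Build R 0 Rplus RplusA Rplus_comm Rplus_0_l.
HB.instance Definition _ := Monoid.isComLaw.Build R 1 Rmult RmultA Rmult_comm Rmult_1_l.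
HB.instance Definition _ := Monoid.isMulLaw.Build R 0 Rmult Rmult_0_l Rmult_0_r.
HB.instance Definition _ := Monoid.isAddLaw.Build R Rmult Rplus RmultDl RmultDr.

Local Notation "\sum_ ( i | P ) F" := (\big[Rplus/0]_(i | P) F) : R_scope.
Local Notation "\sum_ ( i 'in' A ) F" := (\big[Rplus/0]_(i in A) F) : R_scope.
Local Notation "\sum_ ( i 'in' A | P ) F" := (\big[Rplus/0]_(i in A | P) F) : R_scope.
Local Notation "\sum_ ( i : T | P ) F" := (\big[Rplus/0]_(i : T | P) F) : R_scope.
Local Notation "\sum_ ( i : T ) F" := (\big[Rplus/0]_(i : T) F) : R_scope.

Lemma exp_le x y : x <= y -> exp x <= exp y.
Proof. by case=> [/exp_increasing h|->]; [exact: Rlt_le | exact: Rle_refl]. Qed.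

Lemma ln_le x y : 0 < x -> x <= y -> ln x <= ln y.
Proof. by move=> x0 [/(ln_increasing _ _ x0) h|->]; [exact: Rlt_le | exact: Rle_refl]. Qed.

Section RealSums.
Variables (I : finType).
Implicit Types (P Q : pred I) (F G : I -> R).

Lemma ler_rsum P F G : (forall i, P i -> F i <= G i) ->
  \sum_(i | P i) F i <= \sum_(i | P i) G i.
Proof. by move=> h; apply: (big_ind2 Rle) => //; [lra | move=> *; lra]. Qed.

Lemma rsum_ge0 P F : (forall i, P i -> 0 <= F i) -> 0 <= \sum_(i | P i) F i.
Proof. by move=> h; apply: (big_ind (Rle 0)) => //; [lra | move=> *; lra]. Qed.

Lemma ler_rsum_pred P Q F : (forall i, P i -> Q i) -> (forall i, Q i -> 0 <= F i) ->
  \sum_(i | P i) F i <= \sum_(i | Q i) F i.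
Proof.
move=> sPQ F0; rewrite (big_mkcond Q) (big_mkcond P); apply: ler_rsum => i _.
case Pi: (P i); first by rewrite sPQ //; lra.
by case Qi: (Q i); [apply: F0 | lra].
Qed.

Lemma rsum_const (A : {set I}) (c : R) : \sum_(i in A) c = INR #|A| * c.
Proof.
rewrite big_const; elim: #|_| => [|m IH]; first by rewrite /=; lra.
by rewrite iterS IH S_INR; lra.
Qed.

Lemma rsumD P F G : \sum_(i | P i) (F i + G i) = \sum_(i | P i) F i + \sum_(i | P i) G i.
Proof. exact: big_split. Qed.

Lemma rsumMl P F (c : R) : \sum_(i | P i) (c * F i) = c * \sum_(i | P i) F i.
Proof. by rewrite big_distrr. Qed.

Lemma rsumMr P F (c : R) : \sum_(i | P i) (F i * c) = (\sum_(i | P i) F i) * c.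
Proof. by rewrite big_distrl. Qed.

Lemma rsum_ge_term P F (i : I) : P i -> (forall j, P j -> 0 <= F j) ->
  F i <= \sum_(j | P j) F j.
Proof.
move=> Pi F0; rewrite (bigD1 i) //=.
suff : 0 <= \sum_(j | P j && (j != i)) F j by lra.
by apply: rsum_ge0 => j /andP[Pj _]; apply: F0.
Qed.

End RealSums.

Definition indic (b : bool) : R := if b then 1 else 0.

Lemma indic_ge0 b : 0 <= indic b. Proof. by case: b => /=; lra. Qed.
Lemma indic_andb a b : indic (a && b) = indic a * indic b.
Proof. by case: a => /=; rewrite /indic; case: b; lra. Qed.
Lemma indic_le (a b : bool) : (a -> b) -> indic a <= indic b.
Proof. by case: a; case: b => //= h; rewrite /indic; try lra; by case: (notF (h isT)). Qed.

Section ProductMeasure.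
Variables (T : finType) (p : R).
Implicit Types (D E S : {set T}) (f g : {set T} -> R).

(** Expectation over a random subset of [D] containing each element independently with probability
    [p]; probabilities are expectations of [indic]. It serves for the random graph and again, with
    another density, for the random subfamily in [janson]. *)
Definition Ex D f : R :=
  \sum_(S : {set T} | S \subset D) (p ^ #|S| * (1 - p) ^ (#|D| - #|S|) * f S).

Lemma eq_Ex D f g : (forall S, S \subset D -> f S = g S) -> Ex D f = Ex D g.
Proof. by move=> h; apply: eq_bigr => S sS; rewrite h. Qed.

Lemma ExD D f g : Ex D (fun S => f S + g S) = Ex D f + Ex D g.
Proof. by rewrite /Ex -rsumD; apply: eq_bigr => S _; lra. Qed.

Lemma ExZ D (c : R) f : Ex D (fun S => c * f S) = c * Ex D f.
Proof. by rewrite /Ex -rsumMl; apply: eq_bigr => S _; lra. Qed.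

Lemma Ex_sum D (I : finType) (P : pred I) (F : I -> {set T} -> R) :
  Ex D (fun S => \sum_(i | P i) F i S) = \sum_(i | P i) Ex D (F i).
Proof.
rewrite /Ex exchange_big /=; apply: eq_bigr => S _.
by rewrite rsumMl.
Qed.

(** Each [S] avoiding [e] is paired with [e |: S], whose weight is [p / (1 - p)] times as large. The
    factor [1 - p] clears the denominator and keeps all weights relative to [D] instead of
    [D :\ e]. *)
Lemma Ex_split D (e : T) f : e \in D ->
  (1 - p) * Ex D f = \sum_(S : {set T} | (S \subset D) && (e \notin S))
    (p ^ #|S| * (1 - p) ^ (#|D| - #|S|) * ((1 - p) * f S + p * f (e |: S))).
Proof.
move=> eD; rewrite /Ex (bigID (fun S => e \notin S)) /= .
rewrite [X in _ + X](reindex_onto (fun S => e |: S) (fun S => S :\ e)) /=; last first.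
  by move=> S /andP[_]; rewrite negbK => eS; rewrite setD1K.
rewrite [X in _ + X](eq_bigl (fun S => (S \subset D) && (e \notin S))); last first.
  move=> S; rewrite subUset sub1set eD /= setU11 /= andbT.
  case eS: (e \in S) => /=; last by rewrite setU1K ?eS ?eqxx // andbT.
  rewrite andbF; apply/negbTE; rewrite negb_and; apply/orP; right.
  by apply/eqP => h; move: eS; rewrite -h !inE eqxx.
rewrite Rmult_plus_distr_l -!rsumMl -rsumD; apply: eq_bigr => S /andP[sS eS].
have lt : (#|S| < #|D|)%N.
  by apply: proper_card; apply/properP; split=> //; exists e.
rewrite cardsU1 eS /= add1n -(subnSK lt).
by move: (p ^ #|S|) => P /=; ring.
Qed.

Hypothesis p01 : 0 <= p < 1.

Lemma Ex_le D f g : (forall S, S \subset D -> f S <= g S) -> Ex D f <= Ex D g.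
Proof.
move=> h; apply: ler_rsum => S sS; apply: Rmult_le_compat_l; last exact: h.
by apply: Rmult_le_pos; apply: pow_le; lra.
Qed.

Lemma Ex_ge0 D f : (forall S, S \subset D -> 0 <= f S) -> 0 <= Ex D f.
Proof.
move=> h; apply: rsum_ge0 => S sS; apply: Rmult_le_pos; last exact: h.
by apply: Rmult_le_pos; apply: pow_le; lra.
Qed.

Lemma Ex_avoid1 D (e : T) f : e \in D ->
  Ex D (fun S => indic (e \notin S) * f S) = (1 - p) * Ex D (fun S => f (S :\ e)).
Proof.
move=> eD; apply: (Rmult_eq_reg_l (1 - p)); last lra.
rewrite (Ex_split _ eD) (Ex_split (fun S => f (S :\ e)) eD) -rsumMl.
apply: eq_bigr => S /andP[_ eS].
rewrite /indic eS setU11 /= setU1K //.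
have -> : S :\ e = S by apply/setDidPl; rewrite disjoint_sym disjoints1.
ring.
Qed.

Lemma disjointU1r (S E : {set T}) (e : T) : [disjoint S & e |: E] = (e \notin S) && [disjoint S & E].
Proof. by rewrite -!setI_eq0 setIUr setU_eq0 (setI_eq0 S) (disjoint_sym S) disjoints1. Qed.

(* Conditioning on [S] avoiding [E] amounts to deleting [E] from [S]. *)
Lemma Ex_avoid D E f : E \subset D ->
  Ex D (fun S => indic [disjoint S & E] * f S) = (1 - p) ^ #|E| * Ex D (fun S => f (S :\: E)).
Proof.
elim: {E}#|E| {-2}E (erefl #|E|) f => [|m IH] E cE f sED.
  move/eqP: cE; rewrite cards_eq0 => /eqP->; rewrite cards0 /= Rmult_1_l.
  by apply: eq_Ex => S _; rewrite setD0 -setI_eq0 setI0 eqxx /=; lra.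
have [e eE] : exists e, e \in E by apply/set0Pn; rewrite -cards_eq0 cE.
have cE' : #|E :\ e| = m by have := cardsD1 e E; rewrite cE eE add1n => -[].
have sE' : E :\ e \subset D by apply: subset_trans sED; apply: subsetDl.
have eD : e \in D by apply: (subsetP sED).
rewrite -(setD1K eE).
under eq_Ex => S _.
  rewrite disjointU1r indic_andb (Rmult_comm (indic _)) Rmult_assoc; over.
rewrite (IH _ cE' (fun S => indic (e \notin S) * f S)) //.
under eq_Ex => S _.
  rewrite (_ : (e \notin S :\: (E :\ e)) = (e \notin S)); last by rewrite !inE eqxx.
  over.
rewrite (Ex_avoid1 (fun S => f (S :\: (E :\ e)))) // setD1K // cE cE' /=.
under eq_Ex => S _ do rewrite setDDl setD1K //.
ring.
Qed.

(** Only the empty set avoids all of [D], and its weight is [(1 - p) ^ #|D|]; comparing with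
    [Ex_avoid] for [E = D] and cancelling leaves total mass one. *)
Lemma Ex1 D : Ex D (fun=> 1) = 1.
Proof.
have := @Ex_avoid D D (fun=> 1) (subxx _).
rewrite {1}/Ex (bigD1 set0) ?sub0set //= big1 ?Rplus_0_r; last first.
  move=> S /andP[sS S0]; suff -> : [disjoint S & D] = false by rewrite /indic; ring.
  by rewrite -setI_eq0 (setIidPl sS); apply/negbTE.
rewrite cards0 subn0 -setI_eq0 set0I eqxx /indic.
have := pow_lt (1 - p) #|D| ltac:(lra) => q0 h.
by apply: (Rmult_eq_reg_l ((1 - p) ^ #|D|)); [rewrite -h /=; ring | lra].
Qed.

Lemma Pr_avoid D E : E \subset D -> Ex D (fun S => indic [disjoint S & E]) = (1 - p) ^ #|E|.
Proof.
move=> sED; have := Ex_avoid (fun=> 1) sED; rewrite /= Ex1 Rmult_1_r => <-.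
by apply: eq_Ex => S _; ring.
Qed.

(** Generating function of the binomial variable [#|S :&: E|]; at [z = exp 1] it yields the Chernoff
    bound of [Pr_dense_spot]. *)
Lemma Ex_expI D E (z : R) : E \subset D ->
  Ex D (fun S => z ^ #|S :&: E|) = (1 - p + p * z) ^ #|E|.
Proof.
elim: {E}#|E| {-2}E (erefl #|E|) => [|m IH] E cE sED.
  move/eqP: cE; rewrite cards_eq0 => /eqP->; rewrite cards0 /= -[RHS](Ex1 D).
  by apply: eq_Ex => S _; rewrite setI0 cards0.
have [e eE] : exists e, e \in E by apply/set0Pn; rewrite -cards_eq0 cE.
have cE' : #|E :\ e| = m by have := cardsD1 e E; rewrite cE eE add1n => -[].
have sE' : E :\ e \subset D by apply: subset_trans sED; apply: subsetDl.
have eD : e \in D by apply: (subsetP sED).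
rewrite cE /= -[in RHS]cE' -(IH _ cE' sE').
apply: (Rmult_eq_reg_l (1 - p)); last lra.
rewrite (Ex_split _ eD) Rmult_comm Rmult_assoc (Rmult_comm _ (1 - p)).
rewrite (Ex_split (fun S => z ^ #|S :&: (E :\ e)|) eD) -rsumMl.
apply: eq_bigr => S /andP[_ eS].
have -> : S :&: (E :\ e) = S :&: E.
  by apply/setP=> x; rewrite !inE; case: eqVneq => // ->; rewrite (negbTE eS).
have -> : (e |: S) :&: (E :\ e) = S :&: E.
  apply/setP=> x; rewrite !inE; case: eqVneq => // ->; by rewrite (negbTE eS).
have -> : (e |: S) :&: E = e |: (S :&: E) by rewrite setIUl (setIidPl _) ?sub1set.
rewrite cardsU1 inE (negbTE eS) add1n -tech_pow_Rmult.
move: (z ^ _) (p ^ #|S|) => Z P; ring.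
Qed.

Lemma union_bound D (I : finType) (P : pred I) (B : I -> {set T} -> bool) :
  Ex D (fun S => indic [exists i, P i && B i S]) <= \sum_(i | P i) Ex D (fun S => indic (B i S)).
Proof.
rewrite -Ex_sum; apply: Ex_le => S _; case: existsP => [[i /andP[Pi Bi]]|_] /=.
  have := @rsum_ge_term I P (fun i => indic (B i S)) i Pi (fun j _ => indic_ge0 _).
  by rewrite Bi.
by apply: rsum_ge0 => j _; apply: indic_ge0.
Qed.

End ProductMeasure.

(** * Janson's inequality *)

Section Janson.
Variables (I T : finType) (p : R) (D : {set T}) (E : I -> {set T}).
Hypothesis p01 : 0 <= p < 1.
Local Notation q := (1 - p).

(** The events of Janson's inequality are here that [S] avoids [E i]; [hits J S] says that none of
    them occurs for [i] in [J]. *)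
Definition hits (J : {set I}) (S : {set T}) : bool :=
  [forall i in J, ~~ [disjoint S & E i]].

Definition meets (i j : I) : bool := ~~ [disjoint E i & E j].

Lemma hits_subset (J J' : {set I}) S : J \subset J' -> hits J' S -> hits J S.
Proof. by move=> sJ /forall_inP h; apply/forall_inP=> i /(subsetP sJ)/h. Qed.

Lemma hits_mono J (S S' : {set T}) : S \subset S' -> hits J S -> hits J S'.
Proof.
move=> sS /forall_inP h; apply/forall_inP=> i /h; apply: contra.
exact: disjointWl.
Qed.

Lemma hitsU1 i J S : hits (i |: J) S = (~~ [disjoint S & E i] && hits J S) :> bool.
Proof.
apply/forall_inP/andP => [h|[hi /forall_inP h] j].
  by split; [apply: h; rewrite setU11 | apply/forall_inP=> j jJ; apply: h; rewrite setU1r].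
by rewrite in_setU1 => /predU1P[->|/h].
Qed.

(* Boppana and Spencer's step: given the far events [C], the event of [i] is
   independent of [C], and avoiding [E i] and [E j] is negatively correlated
   with [C]. *)
Lemma hits_step i (J : {set I}) : i \notin J -> E i \subset D ->
  (forall j, j \in J -> E j \subset D) ->
  Ex p D (fun S => indic (hits (i |: J) S)) <=
  exp (- q ^ #|E i| + \sum_(j in J | meets i j) q ^ #|E i :|: E j|)
  * Ex p D (fun S => indic (hits J S)).
Proof.
move=> iJ sED sJD.
set M := \sum_(j in J | _) _.
set X := Ex p D (fun S => indic (hits J S)).
have X0 : 0 <= X by apply: Ex_ge0 => // S _; apply: indic_ge0.
suff : Ex p D (fun S => indic (hits (i |: J) S)) <= (1 + (- q ^ #|E i| + M)) * X.
  move=> h; apply: Rle_trans h _; apply: Rmult_le_compat_r => //; exact: exp_ineq1_le.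
(* If the factor is at least 1, monotonicity suffices. Otherwise [q ^ #|E i| - M] is positive, which
   allows [Y] to be replaced by the smaller [X] below. *)
case: (Rle_dec (q ^ #|E i| - M) 0) => hx.
  apply: (Rle_trans _ X).
    by apply: Ex_le => // S _; apply: indic_le; apply: hits_subset; apply: subsetUr.
  rewrite -{1}(Rmult_1_l X); apply: Rmult_le_compat_r => //; lra.
pose F := [set j in J | ~~ meets i j].
set Y := Ex p D (fun S => indic (hits F S)).
have XY : X <= Y.
  apply: Ex_le => // S _; apply: indic_le; apply: hits_subset.
  by apply/subsetP=> j; rewrite inE => /andP[].
have -> : Ex p D (fun S => indic (hits (i |: J) S)) =
    X - Ex p D (fun S => indic [disjoint S & E i] * indic (hits J S)).
  rewrite /X; apply: (Rplus_eq_reg_r (Ex p D (fun S => indic [disjoint S & E i] * indic (hits J S)))).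
  rewrite -ExD (_ : forall a b, a - b + b = a); last by move=> *; ring.
  by apply: eq_Ex => S _; rewrite hitsU1; case: disjoint; case: hits; rewrite /indic /=; ring.
suff : (q ^ #|E i| - M) * Y <= Ex p D (fun S => indic [disjoint S & E i] * indic (hits J S)).
  move=> h; have := Rmult_le_compat_l (q ^ #|E i| - M) _ _ ltac:(lra) XY; lra.
(* When [S] avoids [E i] and hits all far sets, [hits J S] fails only if some near [E j] is avoided
   too; the [G j] add up to a bound for this failure. *)
pose G j (S : {set T}) := indic [disjoint S & E i :|: E j] * indic (hits F S).
apply: (Rle_trans _ (Ex p D (fun S => indic [disjoint S & E i] * indic (hits F S)
    + -1 * \sum_(j in J | meets i j) G j S))); last first.
  apply: Ex_le => // S _.
  have G0 : 0 <= \sum_(j in J | meets i j) G j S.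
    by apply: rsum_ge0 => j _; apply: Rmult_le_pos; apply: indic_ge0.
  case di: [disjoint S & E i]; last by rewrite /indic; case: hits; case: hits; lra.
  case hF: (hits F S); last by rewrite /indic; case: hits; lra.
  case hJ: (hits J S); first by rewrite /indic; lra.
  have /forall_inPn[j jJ] : ~~ hits J S by rewrite hJ.
  rewrite negbK => dj.
  have mij : meets i j.
    apply: contraT => nm; have /forall_inP/(_ j) := hF.
    by rewrite inE jJ nm dj => /(_ isT).
  have := @rsum_ge_term I (fun j => (j \in J) && meets i j) (G^~ S) j.
  rewrite jJ mij => /(_ isT) h.
  have -> : indic true * indic true = 1 by rewrite /indic; lra.
  have -> : indic true * indic false = 0 by rewrite /indic; lra.
  have : 1 <= \sum_(j in J | meets i j) G j S.
    apply: Rle_trans (h _) => [|k _]; last by apply: Rmult_le_pos; apply: indic_ge0.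
    rewrite /G hF -setI_eq0 setIUr setU_eq0 !setI_eq0 di dj /indic /=; lra.
  lra.
rewrite ExD ExZ Ex_sum (@Ex_avoid _ _ p01 D (E i) (fun S => indic (hits F S))) //.
rewrite (_ : Ex p D (fun S => indic (hits F (S :\: E i))) = Y); last first.
  apply: eq_Ex => S _; congr (indic _); apply/forall_inP/forall_inP => h j jF.
    by apply: contra (h _ jF) => dj; apply: disjointWl dj; apply: subsetDl.
  apply: contra (h _ jF); rewrite -!setI_eq0 => /eqP d0.
  move: jF; rewrite inE /meets negbK -setI_eq0 => /andP[_ /eqP dij].
  apply/eqP/setP=> x; move/setP/(_ x): d0; move/setP/(_ x): dij; rewrite !inE.
  by case: (x \in E i); case: (x \in S); case: (x \in E j).
have : \sum_(j in J | meets i j) Ex p D (G j) <= M * Y.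
  rewrite /M -rsumMr; apply: ler_rsum => j /andP[jJ mij].
  rewrite /G (@Ex_avoid _ _ p01 D (E i :|: E j) (fun S => indic (hits F S))); last first.
    by rewrite subUset sED sJD.
  apply: Rmult_le_compat_l; first by apply: pow_le; lra.
  by apply: Ex_le => // S _; apply: indic_le; apply: hits_mono; apply: subsetDl.
lra.
Qed.

(** Multiply [hits_step] along an enumeration of [J]. Each unordered pair is met once, while the
    right side counts ordered pairs; this factor 2 is given away. *)
Lemma hits_le (J : {set I}) : (forall j, j \in J -> E j \subset D) ->
  Ex p D (fun S => indic (hits J S)) <=
  exp (- \sum_(i in J) q ^ #|E i|
       + \sum_(i in J) \sum_(j in J | (j != i) && meets i j) q ^ #|E i :|: E j|).
Proof.
have q0 k : 0 <= q ^ k by apply: pow_le; lra.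
elim: {J}#|J| {-2}J (erefl #|J|) => [|m IH] J cJ sJD.
  move/eqP: cJ; rewrite cards_eq0 => /eqP->; rewrite !big_set0 Ropp_0 Rplus_0_l exp_0.
  rewrite -(Ex1 p01 D); apply: Ex_le => // S _; rewrite /indic; case: hits; lra.
have [i iJ] : exists i, i \in J by apply/set0Pn; rewrite -cards_eq0 cJ.
have cJ' : #|J :\ i| = m by have := cardsD1 i J; rewrite cJ iJ add1n => -[].
have sJ' j : j \in J :\ i -> E j \subset D by rewrite !inE => /andP[_ /sJD].
rewrite -{1}(setD1K iJ).
apply: Rle_trans (hits_step _ _ sJ') _; [by rewrite !inE eqxx | exact: sJD | ].
apply: Rle_trans (Rmult_le_compat_l _ _ _ _ (IH _ cJ' sJ')) _.
  exact: Rlt_le (exp_pos _).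
rewrite -exp_plus; apply: exp_le; rewrite !(big_setD1 i iJ) /=.
have -> : \sum_(j in J | (j != i) && meets i j) q ^ #|E i :|: E j| =
          \sum_(j in J :\ i | meets i j) q ^ #|E i :|: E j|.
  by apply: eq_bigl => j; rewrite !inE andbA (andbC (j \in J)).
have : \sum_(a in J :\ i) \sum_(j in J :\ i | (j != a) && meets a j) q ^ #|E a :|: E j|
    <= \sum_(a in J :\ i) \sum_(j in J | (j != a) && meets a j) q ^ #|E a :|: E j|.
  apply: ler_rsum => a _; apply: ler_rsum_pred => [j|j _]; last exact: q0.
  by rewrite !inE => /andP[/andP[_ ->] ->].
lra.
Qed.

(* Janson's inequality in the range [mu <= Delta]: apply [hits_le] to a random
   subfamily of [X] of density [mu / (2 Delta)]. *)
Lemma janson (X : {set I}) (mu Delta : R) : (forall j, j \in X -> E j \subset D) ->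
  (forall j, j \in X -> E j != set0) -> 0 < mu ->
  mu <= \sum_(i in X) q ^ #|E i| ->
  \sum_(i in X) \sum_(j in X | meets i j) q ^ #|E i :|: E j| <= Delta ->
  Ex p D (fun S => indic (hits X S)) <= exp (- (mu * mu) / (4 * Delta)).
Proof.
move=> sXD X0 mu0 muX hDelta.
set P0 := Ex _ _ _.
have q0 k : 0 <= q ^ k by apply: pow_le; lra.
have muD : \sum_(i in X) q ^ #|E i| <= Delta.
  apply: Rle_trans hDelta; apply: ler_rsum => i iX.
  have mii : (i \in X) && meets i i by rewrite iX /meets -setI_eq0 setIid X0.
  rewrite (bigD1 i mii) /= setUid.
  suff : 0 <= \sum_(j | ((j \in X) && meets i j) && (j != i)) q ^ #|E i :|: E j| by lra.
  by apply: rsum_ge0 => *; apply: q0.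
pose M := \sum_(i in X) q ^ #|E i|.
case: (Rle_lt_dec P0 0) => hP; first by apply: Rle_trans hP (Rlt_le _ _ (exp_pos _)).
pose lam := mu / (2 * Delta).
have D0 : 0 < Delta by lra.
have lam0 : 0 < lam by apply: Rdiv_lt_0_compat; lra.
have lam1 : lam <= 1/2.
  rewrite /lam; apply: (Rmult_le_reg_r (2 * Delta)); first lra.
  rewrite /Rdiv Rmult_assoc Rinv_l; lra.
have r01 : 0 <= 1 - lam < 1 by lra.
(* [W] is the discarded part, of density [1 - lam], and [X :\: W] the subfamily kept. After taking
   logarithms the bound is linear in the indicators, so it can be averaged over [W] instead of
   choosing a good [W]. *)
have key (W : {set I}) : - ln P0 >=
    \sum_(i in X) indic [disjoint W & [set i]] * q ^ #|E i|
    + -1 * \sum_(i in X) \sum_(j in X | (j != i) && meets i j)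
        indic [disjoint W & [set i; j]] * q ^ #|E i :|: E j|.
  have h1 : P0 <= Ex p D (fun S => indic (hits (X :\: W) S)).
    by apply: Ex_le => // S _; apply: indic_le; apply: hits_subset; apply: subsetDl.
  have h2 := @hits_le (X :\: W) (fun j jX => sXD j (subsetP (subsetDl _ _) _ jX)).
  have := ln_le hP (Rle_trans _ _ _ h1 h2); rewrite ln_exp.
  have -> : \sum_(i in X :\: W) q ^ #|E i| =
      \sum_(i in X) indic [disjoint W & [set i]] * q ^ #|E i|.
    rewrite big_mkcond [in RHS]big_mkcond; apply: eq_bigr => i _.
    rewrite inE disjoint_sym disjoints1; case: (i \in X); case: (i \in W); rewrite /indic /=; lra.
  have -> : \sum_(i in X :\: W) \sum_(j in X :\: W | (j != i) && meets i j) q ^ #|E i :|: E j|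
    = \sum_(i in X) \sum_(j in X | (j != i) && meets i j)
        indic [disjoint W & [set i; j]] * q ^ #|E i :|: E j|.
    have dE i j : [disjoint W & [set i; j]] = (i \notin W) && (j \notin W).
      by rewrite disjointU1r (disjoint_sym W) disjoints1.
    rewrite big_mkcond [in RHS]big_mkcond; apply: eq_bigr => i _.
    rewrite inE; case iX: (i \in X); rewrite ?andbF //.
    case iW: (i \in W) => /=.
      by rewrite big1 // => j _; rewrite dE iW /indic /=; lra.
    rewrite big_mkcond [in RHS]big_mkcond; apply: eq_bigr => j _; rewrite dE iW inE /=.
    case: (j \in X); case: (j \in W); case: (j != i); case: (meets i j); rewrite /indic /=; lra.
  lra.
have : - ln P0 >= lam * M + -1 * (lam * lam * Delta).
  have -> : - ln P0 = Ex (1 - lam) [set: I] (fun=> - ln P0 * 1).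
    by rewrite ExZ Ex1 //; lra.
  apply: Rle_ge; apply: Rle_trans (Ex_le r01 (fun W _ =>
    Rle_trans _ _ _ (Rge_le _ _ (key W)) (Req_le _ _ (esym (Rmult_1_r _))))).
  rewrite ExD ExZ !Ex_sum.
  have -> : \sum_(i in X) Ex (1 - lam) [set: I] (fun W => indic [disjoint W & [set i]] * q ^ #|E i|)
      = lam * M.
    rewrite /M -rsumMl; apply: eq_bigr => i _.
    rewrite (@eq_Ex _ _ _ _ (fun W => q ^ #|E i| * indic [disjoint W & [set i]])); last by move=> *; ring.
    by rewrite ExZ Pr_avoid ?subsetT // cards1 /=; ring.
  have : \sum_(i in X) Ex (1 - lam) [set: I] (fun W =>
            \sum_(j in X | (j != i) && meets i j) indic [disjoint W & [set i; j]] * q ^ #|E i :|: E j|)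
       <= lam * lam * Delta; last by lra.
  apply: Rle_trans (Rmult_le_compat_l (lam * lam) _ _ _ hDelta); last by nra.
  rewrite -rsumMl; apply: ler_rsum => i iX; rewrite Ex_sum -rsumMl.
  apply: (Rle_trans _ (\sum_(j in X | (j != i) && meets i j) (lam * lam * q ^ #|E i :|: E j|))); last first.
    apply: ler_rsum_pred => [j /andP[-> /andP[_ ->]] //|j _].
    by have := q0 #|E i :|: E j|; nra.
  apply: ler_rsum => j /andP[_ /andP[ji _]]; apply: Req_le.
  rewrite (@eq_Ex _ _ _ _ (fun W => q ^ #|E i :|: E j| * indic [disjoint W & [set i; j]])); last by move=> *; ring.
  by rewrite ExZ Pr_avoid ?subsetT // cards2 eq_sym ji /=; ring.
have -> : - (mu * mu) / (4 * Delta) = - (lam * mu + -1 * (lam * lam * Delta)).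
  by rewrite /lam; field; lra.
move=> h; rewrite -(exp_ln _ hP); apply: exp_le.
have := Rmult_le_compat_l lam mu M ltac:(lra) muX; lra.
Qed.

End Janson.

(** * Counting subsets *)

Section Counting.

Lemma card_supersets (T : finType) (U W : {set T}) (k : nat) :
  W \subset U ->
  (#|[set J : {set T} | [&& W \subset J, J \subset U & #|J| == k]]| <= 'C(#|U| - #|W|, k - #|W|))%N.
Proof.
move=> sWU; rewrite -cardsDS // -cards_draws.
set A := [set J | _]; rewrite -(card_in_imset (f := fun J => J :\: W) (D := A)); last first.
  move=> J J'; rewrite !inE => /andP[sJ _] /andP[sJ' _] e.
  by rewrite -(setID J W) -(setID J' W) e (setIidPr sJ) (setIidPr sJ').
apply/subset_leq_card/subsetP=> _ /imsetP[J + ->].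
by rewrite !inE => /and3P[sJ sJU /eqP<-]; rewrite setSD //= cardsDS.
Qed.

Lemma subset_of_card (T : finType) (A : {set T}) s : (s <= #|A|)%N ->
  exists2 B : {set T}, B \subset A & #|B| = s.
Proof.
move=> sA; have : (0 < #|[set B : {set T} | B \subset A & #|B| == s]|)%N.
  by rewrite cards_draws bin_gt0.
by case/card_gt0P=> B; rewrite inE => /andP[sB /eqP cB]; exists B.
Qed.

(** The fraction of [k]-subsets of an [m]-set that contain a given [i]-set is the product of the
    [(k - j) / (m - j)] with [j < i], each at most [k / m]. *)
Lemma bin_sub_ratio (m k i : nat) : (k <= m)%N -> (i <= k)%N ->
  ('C(m - i, k - i) * m ^ i <= 'C(m, k) * k ^ i)%N.
Proof.
move=> km; elim: i => [|i IH] ik; first by rewrite !subn0 !expn0.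
have im : (i < m)%N by apply: leq_trans km.
have := mul_bin_diag (m - i) (k - i.+1); rewrite subnSK // -subnS => e.
have h : ('C(m - i.+1, k - i.+1) * m <= k * 'C(m - i, k - i))%N.
  have h0 : ((k - i) * m <= k * (m - i))%N.
    by rewrite mulnBl mulnBr leq_sub2l // mulnC leq_mul2l km orbT.
  rewrite -(leq_pmul2l (_ : 0 < m - i)%N) ?subn_gt0 // mulnA e mulnAC.
  by rewrite mulnA (mulnC (m - i)%N) leq_mul2r h0 orbT.
apply: (@leq_trans ((k * 'C(m - i, k - i)) * m ^ i)%N).
  by rewrite expnS mulnA leq_mul2r h orbT.
by rewrite -mulnA [(k ^ i.+1)%N]expnS [leqRHS]mulnCA leq_mul2l IH ?orbT // ltnW.
Qed.

Lemma sum_subsets_card (T : finType) (A : {set T}) (g : nat -> R) :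
  \sum_(W : {set T} | W \subset A) g #|W| =
  \big[Rplus/0]_(i < #|A|.+1) (INR 'C(#|A|, i) * g i).
Proof.
rewrite (partition_big (fun W : {set T} => inord #|W| : 'I_#|A|.+1) xpredT) //=.
apply: eq_bigr => i _.
rewrite -cards_draws -rsum_const; apply: congr_big => // [W|W].
  rewrite inE; case sW: (W \subset A) => //=.
  by rewrite -(inj_eq val_inj) /= inordK // ltnS subset_leq_card.
case/andP=> sW /eqP<-; congr g.
by rewrite inordK // ltnS subset_leq_card.
Qed.

Lemma sum_pow_subsets (T : finType) (x : R) :
  \sum_(W : {set T}) x ^ #|W| = (1 + x) ^ #|T|.
Proof.
have prodC (A : {set T}) (y : R) : \big[Rmult/1]_(i in A) y = y ^ #|A|.
  by rewrite big_const; elim: #|_| => //= m ->.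
have /= := @bigA_distr R 0 1 Rmult Rplus T (fun=> x) (fun=> 1).
rewrite (_ : \big[Rmult/1]_(i : T) (x + 1) = (1 + x) ^ #|T|); last first.
  by rewrite -cardsT -prodC; apply: congr_big => // [i|i _]; [rewrite inE | lra].
move=> ->; apply: eq_big => [J|J _]; first by rewrite inE.
rewrite -big_mkcond; exact/esym/prodC.
Qed.

Lemma exp_pow (x : R) (m : nat) : exp x ^ m = exp (INR m * x).
Proof.
elim: m => [|m IH]; first by rewrite /= Rmult_0_l exp_0.
by rewrite S_INR /= IH -exp_plus; congr exp; lra.
Qed.

Lemma bin_pow_le (n s : nat) (x : R) : 0 <= x -> INR 'C(n, s) * x ^ s <= (1 + x) ^ n.
Proof.
move=> x0; rewrite -{1 2}(card_ord n) -card_draws -rsum_const -sum_pow_subsets.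
apply: Rle_trans (ler_rsum_pred (P := mem [set A : {set 'I_n} | #|A| == s]) _ _).
- by apply: Req_le; apply: eq_bigr => A; rewrite inE => /eqP->.
- by [].
by move=> A _; apply: pow_le.
Qed.

(** At [x = s / n] this is the bound [(e n / s)^s] on the binomial coefficient. *)
Lemma bin_exp_le (n s : nat) (x : R) : 0 <= x -> INR 'C(n, s) * x ^ s <= exp (INR n * x).
Proof.
move=> x0; apply: Rle_trans (bin_pow_le n s x0) _.
by rewrite -exp_pow; apply: pow_incr; have := exp_ineq1_le x; lra.
Qed.

Lemma bin_le_exp (n s : nat) : ('C(n, s) <= n ^ s)%N.
Proof.
elim: s => [|s IH]; first by rewrite bin0 expn0.
apply: (@leq_trans (s.+1 * 'C(n, s.+1))%N); first by rewrite leq_pmull.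
by rewrite mul_bin_left expnS leq_mul ?leq_subr.
Qed.

Lemma INR_bin2 (n : nat) : INR 'C(n, 2) = INR n * (INR n - 1) / 2.
Proof.
case: n => [|n]; first by rewrite /=; lra.
have := mul_bin_left n.+1 1; rewrite bin1 subSS subn0 => /(congr1 INR).
rewrite !mult_INR !S_INR [INR 0]/=; lra.
Qed.

Lemma INR_expn (a b : nat) : INR (a ^ b)%N = INR a ^ b.
Proof. by elim: b => //= b IH; rewrite expnS mult_INR IH. Qed.

End Counting.

(** * Vertex pairs inside a set and independence *)

Section Pairs.
Variable n : nat.
Implicit Types (A B W U : {set 'I_n}) (S : {set 'I_n * 'I_n}).

Definition pairs A : {set 'I_n * 'I_n} := [set e in upairs n | (e.1 \in A) && (e.2 \in A)].

Lemma pairs_sub A : pairs A \subset upairs n.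
Proof. by apply/subsetP=> e; rewrite inE => /andP[]. Qed.

Lemma pairsI A B : pairs A :&: pairs B = pairs (A :&: B).
Proof.
apply/setP=> e; rewrite !inE; case: (e.1 < e.2)%N => //=.
by case: (e.1 \in A); case: (e.1 \in B); case: (e.2 \in A); case: (e.2 \in B).
Qed.

(** Swapping coordinates matches the pairs below the diagonal with those above. Both the size of
    [pairs A] and the handshake identity rest on this. *)
Lemma card_sym_rel (r : rel 'I_n) : symmetric r -> irreflexive r ->
  #|[set e : 'I_n * 'I_n | r e.1 e.2]| = (2 * #|[set e in upairs n | r e.1 e.2]|)%N.
Proof.
move=> sr ir; set A := [set e : 'I_n * 'I_n | r e.1 e.2]; set B := [set e in upairs n | r e.1 e.2].
rewrite -(cardsID (upairs n) A) mul2n -addnn; congr (_ + _)%N.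
  by apply: eq_card => e; rewrite !inE andbC.
have swapK : involutive (fun e : 'I_n * 'I_n => (e.2, e.1)) by case.
rewrite -(card_preimset B (inv_inj swapK)); apply: eq_card => -[u v].
rewrite !inE /= sr.
by case: (ltngtP u v) => //= /val_inj->; rewrite ir.
Qed.

Lemma card_pairs A : #|pairs A| = 'C(#|A|, 2).
Proof.
pose r u v := [&& u \in A, v \in A & u != v].
have sr : symmetric r by move=> u v; rewrite /r eq_sym andbCA.
have ir : irreflexive r by move=> u; rewrite /r eqxx !andbF.
have h := card_sym_rel sr ir.
have e1 : [set e in upairs n | r e.1 e.2] = pairs A.
  apply/setP=> -[u v]; rewrite !inE /r /=; case: ltngtP => // uv /=.
  have -> : u != v by rewrite -(inj_eq val_inj) neq_ltn uv.
  by rewrite andbT.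
rewrite bin2 -(doubleK #|pairs A|) -mul2n -e1 -h; congr _./2.
have -> : [set e | r e.1 e.2] = setX A A :\: [set (x, x) | x in A].
  apply/setP=> -[u v]; rewrite !inE /r /=.
  case uA: (u \in A); last by rewrite andbF.
  case vA: (v \in A); last by rewrite !andbF.
  rewrite /= ?andbT; congr (~~ _); apply/eqP/imsetP => [<-|[x _ [-> ->]] //].
  by exists u.
rewrite cardsDS; last by apply/subsetP=> _ /imsetP[x xA ->]; rewrite inE xA.
rewrite cardsX card_imset; last by move=> x y [].
by case: #|A| => // a; rewrite mulnS addKn mulnC.
Qed.

Lemma card_pairsU A B :
  (#|pairs A :|: pairs B| + 'C(#|A :&: B|, 2) = 'C(#|A|, 2) + 'C(#|B|, 2))%N.
Proof. by rewrite -!card_pairs -pairsI cardsUI. Qed.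

(** Stated as avoidance of a set of pairs, so that [Pr_avoid] and [janson] apply as they stand. *)
Definition indep S A : bool := [disjoint S & pairs A].

Lemma indepP S A : S \subset upairs n ->
  reflect {in A &, forall u v, ~~ adj S u v} (indep S A).
Proof.
move=> sS; apply: (iffP idP) => [dS u v uA vA|h].
  have hS e : e \in S -> e.1 \in A -> e.2 \in A -> False.
    move=> eS e1 e2; have := disjointFr dS eS.
    by rewrite inE e1 e2 (subsetP sS _ eS).
  by apply/negP=> /andP[_ /orP[] /hS]; apply.
rewrite /indep -setI_eq0; apply/eqP/setP=> -[u v]; rewrite !inE /=.
apply/negP=> /andP[eS /andP[uv /andP[uA vA]]].
have := h u v uA vA; rewrite /adj eS -(inj_eq val_inj) /= neq_ltn uv.
by [].
Qed.

End Pairs.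

(** * Independent sets in the random graph *)

Section RandomGraph.
Variables (n : nat) (p : R).
Hypothesis p01 : 0 <= p < 1.
Local Notation q := (1 - p).
Local Notation Pr B := (Ex p (upairs n) (fun S => indic (B S))).
Implicit Types (A I J U W : {set 'I_n}) (S : {set 'I_n * 'I_n}).

Lemma Pr_large_indep (s : nat) :
  Pr (fun S => [exists I : {set 'I_n}, (#|I| == s) && indep S I]) <= INR 'C(n, s) * q ^ 'C(s, 2).
Proof.
apply: Rle_trans (union_bound p01 _ (fun I : {set 'I_n} => #|I| == s) (fun I S => indep S I)) _.
rewrite -[in INR _](card_ord n) -card_draws -rsum_const.
apply: Req_le; apply: eq_big => [I|I /eqP cI]; first by rewrite inE.
by rewrite Pr_avoid ?pairs_sub // card_pairs cI.
Qed.

Section ConflictFreeSets.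
Variables (H : rel 'I_n) (h m k : nat) (U : {set 'I_n}).

(** The candidates for one greedy removal: [H] will be the relation of sharing a colour in an
    earlier colouring. *)
Definition free_sets : {set {set 'I_n}} :=
  [set I : {set 'I_n} | [&& I \subset U, #|I| == k & [forall u in I, forall v in I, (u != v) ==> ~~ H u v]]].

(** At least half of all [k]-subsets of [U] are free: there are at most [m * h] conflicting pairs,
    each lies in at most a fraction [(k / m)^2] of the [k]-sets, and [h * k^2 / m <= 1/2]. *)
Lemma card_free_sets : #|U| = m -> (0 < m)%N -> (1 < k)%N -> (k <= m)%N ->
  (forall u, (#|[set v | (u != v) && H u v]| <= h)%N) -> (2 * h * k ^ 2 <= m)%N ->
  ('C(m, k) <= 2 * #|free_sets|)%N.
Proof.
move=> cU m0 k1 km Hh hk.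
pose X := [set I : {set 'I_n} | I \subset U & #|I| == k].
have sX : free_sets \subset X by apply/subsetP=> I; rewrite !inE => /and3P[-> ->].
have cX : #|X| = 'C(m, k) by rewrite /X cards_draws cU.
pose P := [set e : 'I_n * 'I_n | (e.1 \in U) && ((e.1 != e.2) && H e.1 e.2) && (e.2 \in U)].
pose F (e : 'I_n * 'I_n) := [set J : {set 'I_n} | [&& [set e.1; e.2] \subset J, J \subset U & #|J| == k]].
have sB : X :\: free_sets \subset \bigcup_(e in P) F e.
  apply/subsetP=> I; rewrite !inE => /andP[nf /andP[sI cI]]; move: nf; rewrite sI cI /=.
  case/forall_inPn=> u uI /forall_inPn[v vI]; rewrite negb_imply negbK => uv.
  apply/bigcupP; exists (u, v); rewrite !inE /= ?uv ?(subsetP sI) //.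
  by rewrite subUset !sub1set uI vI sI cI.
have cP : (#|P| <= m * h)%N.
  rewrite -cU -sum_nat_const -sum1_card.
  rewrite (eq_bigl (fun e : 'I_n * 'I_n => (e.1 \in U) && (((e.1 != e.2) && H e.1 e.2) && (e.2 \in U)))); last first.
    by move=> e; rewrite inE -andbA.
  rewrite -(pair_big_dep (mem U) (fun u v => ((u != v) && H u v) && (v \in U)) (fun _ _ => 1%N)) /=.
  apply: leq_sum => u _; rewrite sum1_card; apply: leq_trans (Hh u).
  by apply: subset_leq_card; apply/subsetP=> v; rewrite !inE unfold_in => /andP[].
have cF e : e \in P -> (#|F e| * m ^ 2 <= 'C(m, k) * k ^ 2)%N.
  rewrite inE => /andP[/andP[e1 /andP[ne _]] e2].
  apply: leq_trans (bin_sub_ratio km k1); rewrite leq_mul2r; apply/orP; right.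
  have := @card_supersets _ U [set e.1; e.2] k; rewrite cards2 ne cU; apply.
  by rewrite subUset !sub1set e1 e2.
have hB : (#|X :\: free_sets| * m ^ 2 <= (m * h) * ('C(m, k) * k ^ 2))%N.
  apply: (@leq_trans (\sum_(e in P) #|F e| * m ^ 2)%N).
    rewrite -big_distrl leq_mul2r; apply/orP; right.
    apply: leq_trans (subset_leq_card sB) _.
    by apply: (big_ind2 (fun (A : {set {set 'I_n}}) a => (#|A| <= a)%N)) => [|A a B b Aa Bb|//];
       [rewrite cards0 | apply: leq_trans (leq_card_setU A B) (leq_add Aa Bb)].
  apply: (@leq_trans (\sum_(e in P) 'C(m, k) * k ^ 2)%N); first exact: leq_sum.
  by rewrite sum_nat_const leq_mul2r cP orbT.
have : (2 * #|X :\: free_sets| <= 'C(m, k))%N.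
  rewrite -(leq_pmul2r (_ : 0 < m ^ 2)%N) ?expn_gt0 ?m0 // -mulnA.
  apply: leq_trans (leq_mul (leqnn 2) hB) _.
  rewrite (_ : 2 * (m * h * ('C(m, k) * k ^ 2)) = (2 * h * k ^ 2) * (m * 'C(m, k)))%N; last first.
    by rewrite -!multE; ring.
  apply: leq_trans (leq_mul hk (leqnn _)) _.
  by rewrite -mulnn mulnA mulnC.
have := cardsID free_sets X; rewrite cX (setIidPr sX) => <-.
rewrite mul2n -addnn => hh; rewrite mul2n -addnn leq_add2l.
by move: hh; rewrite leq_add2r.
Qed.

(** Janson with [mu = #|X| Q] and [Delta = #|X| Cm Q^2 B]. The index [i] in the sum is the size of
    the intersection of two [k]-sets, whose pairs meet only if [i >= 2]. The exponent is
    [#|X| / (4 Cm B)], and [#|X| >= Cm / 2]. *)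
Lemma Pr_no_indep_free_set (B : R) : #|U| = m -> (1 < k)%N -> (k <= m)%N ->
  ('C(m, k) <= 2 * #|free_sets|)%N ->
  \big[Rplus/0]_(i < k.+1 | (1 < i)%N) (INR 'C(k, i) * (INR k / INR m) ^ i / q ^ 'C(i, 2)) <= B ->
  Pr (fun S => [forall I in free_sets, ~~ indep S I]) <= exp (- / (8 * B)).
Proof.
move=> cU k1 km hX hB.
set X := free_sets; set Q := q ^ 'C(k, 2); set Cm := INR 'C(m, k).
have q0 i : 0 < q ^ i by apply: pow_lt; lra.
have Q0 : 0 < Q by apply: q0.
have m0 : 0 < INR m by apply/lt_0_INR/ltP/(leq_trans _ km)/(leq_trans _ k1).
have Cm0 : 0 < Cm by apply/lt_0_INR/ltP; rewrite bin_gt0.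
have XC : Cm <= 2 * INR #|X| by rewrite -[2]/(INR 2) -mult_INR; apply/le_INR/leP.
have B0 : 0 < B.
  apply: Rlt_le_trans hB.
  apply: Rlt_le_trans (@rsum_ge_term 'I_k.+1 (fun i => (1 < i)%N) _ ord_max _ _) => //=.
    rewrite binn /Rdiv Rmult_1_l; apply: Rmult_lt_0_compat; last exact: Rinv_0_lt_compat.
    by apply: pow_lt; apply: Rdiv_lt_0_compat => //; apply/lt_0_INR/ltP; apply: ltnW.
  move=> i _; apply: Rmult_le_pos; last exact/Rlt_le/Rinv_0_lt_compat.
  apply: Rmult_le_pos; first exact: pos_INR.
  by apply: pow_le; apply: Rmult_le_pos; [exact: pos_INR | exact/Rlt_le/Rinv_0_lt_compat].
have inX I : I \in X -> I \subset U /\ #|I| = k by rewrite inE => /and3P[-> /eqP].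
have XQ : \sum_(I in X) q ^ #|pairs I| = INR #|X| * Q.
  by rewrite -rsum_const; apply: eq_bigr => I /inX[_ cI]; rewrite card_pairs cI.
have Xp : 0 < INR #|X| by lra.
apply: Rle_trans (@janson {set 'I_n} _ p (upairs n) (@pairs n) p01 X (INR #|X| * Q)
  (INR #|X| * (Cm * (Q * Q) * B)) _ _ _ _ _) _.
- by move=> I _; apply: pairs_sub.
- by move=> I /inX[_ cI]; rewrite -cards_eq0 card_pairs cI -lt0n bin_gt0.
- exact: Rmult_lt_0_compat.
- by rewrite XQ; apply: Rle_refl.
- rewrite -rsum_const; apply: ler_rsum => I /inX[sI cI].
  pose f i := if (1 < i)%N then Q * Q / q ^ 'C(i, 2) else 0.
  have f0 i : 0 <= f i.
    rewrite /f; case: ifP => _; last lra.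
    by apply: Rlt_le; apply: Rdiv_lt_0_compat => //; nra.
  (* The exact term for [J] is the one with [W = I :&: J]. Admitting every [W] inside both sets only
     enlarges the sum, and after exchanging the sums it remains to count supersets of [W]. *)
  apply: (Rle_trans _ (\sum_(J in X) \sum_(W : {set 'I_n} | W \subset I) (indic (W \subset J) * f #|W|))).
    rewrite big_mkcondr; apply: ler_rsum => J /inX[sJ cJ].
    have s0 W : W \subset I -> 0 <= indic (W \subset J) * f #|W|.
      by move=> _; apply: Rmult_le_pos => //; apply: indic_ge0.
    case: ifP => [mIJ|_]; last exact: rsum_ge0.
    have := rsum_ge_term (subsetIl I J) s0; rewrite subsetIr /indic Rmult_1_l.
    apply: Rle_trans; apply: Req_le; rewrite /f.
    have -> : (1 < #|I :&: J|)%N.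
      by move: mIJ; rewrite /meets -setI_eq0 pairsI -cards_eq0 card_pairs -lt0n bin_gt0.
    have hU := card_pairsU I J; rewrite cI cJ in hU.
    apply: (Rmult_eq_reg_r (q ^ 'C(#|I :&: J|, 2))); last exact/Rgt_not_eq/q0.
    rewrite -pow_add plusE hU /Rdiv Rmult_assoc Rinv_l ?Rmult_1_r; last exact/Rgt_not_eq/q0.
    by rewrite -plusE pow_add.
  rewrite exchange_big /=.
  apply: (Rle_trans _ (\sum_(W : {set 'I_n} | W \subset I) (Cm * ((INR k / INR m) ^ #|W| * f #|W|)))).
    apply: ler_rsum => W sW; rewrite rsumMr -Rmult_assoc; apply: Rmult_le_compat_r => //.
    have sWU := subset_trans sW sI.
    have Wk : (#|W| <= k)%N by rewrite -cI subset_leq_card.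
    apply: (Rle_trans _ (INR 'C(m - #|W|, k - #|W|))).
      apply: Rle_trans (le_INR _ _ (leP (leq_trans (card_supersets k sWU) _))); last by rewrite cU.
      rewrite -[X in _ <= X]Rmult_1_r -rsum_const big_mkcond [X in _ <= X]big_mkcond.
      apply: ler_rsum => J _; rewrite inE; case JX: (J \in X); last by case: ifP; lra.
      have [sJ cJ] := inX _ JX; rewrite sJ cJ eqxx andbT /indic; case: (W \subset J) => /=; lra.
    apply: (Rmult_le_reg_r (INR m ^ #|W|)); first exact: pow_lt.
    rewrite Rmult_assoc -Rpow_mult_distr /Rdiv Rmult_assoc Rinv_l ?Rmult_1_r; last exact: Rgt_not_eq.
    rewrite -!INR_expn -!mult_INR; apply: le_INR; apply/leP; exact: bin_sub_ratio.
  rewrite rsumMl Rmult_assoc; apply: Rmult_le_compat_l; first exact: Rlt_le.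
  rewrite (sum_subsets_card I (fun i => (INR k / INR m) ^ i * f i)) cI.
  apply: Rle_trans (Rmult_le_compat_l (Q * Q) _ _ _ hB); last by nra.
  rewrite -rsumMl [X in _ <= X]big_mkcond; apply: ler_rsum => i _.
  by rewrite /f; case: ifP => _; apply: Req_le; rewrite /Rdiv; ring.
apply: exp_le.
have -> : - (INR #|X| * Q * (INR #|X| * Q)) / (4 * (INR #|X| * (Cm * (Q * Q) * B))) =
  - (INR #|X| / (4 * Cm * B)) by field; repeat split; lra.
apply: Ropp_le_contravar; apply: (Rmult_le_reg_r (8 * Cm * B)); first by nra.
have -> : / (8 * B) * (8 * Cm * B) = Cm by field; lra.
have -> : INR #|X| / (4 * Cm * B) * (8 * Cm * B) = 2 * INR #|X| by field; lra.
done.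
Qed.

End ConflictFreeSets.
End RandomGraph.

(** * Failure events of the greedy construction *)

Section BadEvents.
Variables (n : nat) (p : R).
Hypothesis p01 : 0 <= p < 1.
Local Notation q := (1 - p).
Local Notation Pr B := (Ex p (upairs n) (fun S => indic (B S))).
Implicit Types (A I J U W : {set 'I_n}) (S : {set 'I_n * 'I_n}).

Definition clash t (c : {ffun 'I_t -> {ffun 'I_n -> 'I_n}}) : rel 'I_n :=
  fun u v => [exists i, c i u == c i v].

(** A condition that does not mention the graph, so that the union bound runs over deterministic
    colourings. It bounds the clash degree by [t * K], and proper colourings satisfy it with [K] a
    bound on the independence number. *)
Definition small_classes t (K : nat) (c : {ffun 'I_t -> {ffun 'I_n -> 'I_n}}) : bool :=
  [forall i, forall x, (#|[set v | c i v == x]| <= K)%N].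

(* Some [m]-set contains no independent [k]-set meeting each class of the [t] given colorings,
   whose classes have at most [K] elements, at most once. *)
Definition stuck (t k m K : nat) S : bool :=
  [exists w : {set 'I_n} * {ffun 'I_t -> {ffun 'I_n -> 'I_n}},
    ((#|w.1| == m) && small_classes K w.2)
    && [forall I in free_sets (clash w.2) k w.1, ~~ indep S I]].

Lemma clash_degree t K c u : @small_classes t K c ->
  (#|[set v | (u != v) && clash c u v]| <= t * K)%N.
Proof.
move=> /forallP hc.
apply: (@leq_trans #|\bigcup_(i : 'I_t) [set v | c i v == c i u]|).
  apply: subset_leq_card; apply/subsetP=> v; rewrite inE => /andP[_ /existsP[i /eqP e]].
  by apply/bigcupP; exists i; rewrite // inE e.
rewrite -[in leqRHS](card_ord t) -sum_nat_const.
apply: (big_ind2 (fun (A : {set 'I_n}) a => (#|A| <= a)%N)) => [|A a B b Aa Bb|i _].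
- by rewrite cards0.
- exact: leq_trans (leq_card_setU A B) (leq_add Aa Bb).
- exact: (forallP (hc i)).
Qed.

Lemma Pr_stuck (t k m K : nat) (B : R) : (1 < k)%N -> (k <= m)%N ->
  (2 * (t * K) * k ^ 2 <= m)%N ->
  \big[Rplus/0]_(i < k.+1 | (1 < i)%N) (INR 'C(k, i) * (INR k / INR m) ^ i / q ^ 'C(i, 2)) <= B ->
  Pr (stuck t k m K) <= INR (2 ^ n * (n ^ n) ^ t) * exp (- / (8 * B)).
Proof.
move=> k1 km hK hB.
apply: Rle_trans (@union_bound _ _ p01 _ ({set 'I_n} * {ffun 'I_t -> {ffun 'I_n -> 'I_n}})%type
  (fun w => (#|w.1| == m) && small_classes K w.2)
  (fun w S => [forall I in free_sets (clash w.2) k w.1, ~~ indep S I])) _.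
have -> : (2 ^ n * (n ^ n) ^ t)%N =
    #|[set: {set 'I_n} * {ffun 'I_t -> {ffun 'I_n -> 'I_n}}]|.
  rewrite cardsT card_prod !card_ffun !card_ord; congr (_ * _)%N.
  by rewrite -cardsT -powersetT card_powerset cardsT card_ord.
rewrite -rsum_const.
apply: (Rle_trans _ (\sum_(w : {set 'I_n} * {ffun 'I_t -> {ffun 'I_n -> 'I_n}}
    | (#|w.1| == m) && small_classes K w.2) exp (- / (8 * B)))).
  apply: ler_rsum => -[U c] /= /andP[/eqP cU hc].
  apply: (Pr_no_indep_free_set p01 cU k1 km) => //.
  apply: (card_free_sets cU) hK => //; first by apply: leq_trans km; apply: ltnW.
  by move=> u; apply: clash_degree.
apply: ler_rsum_pred => [w|w _]; first by rewrite inE.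
exact/Rlt_le/exp_pos.
Qed.

Definition dense_spot (m d : nat) S : bool :=
  [exists W : {set 'I_n}, ((W != set0) && (#|W| <= m)%N)
    && [forall v in W, (d < #|[set u in W | adj S v u]|)%N]].

Lemma sum_degrees S W : S \subset upairs n ->
  (\sum_(v in W) #|[set u in W | adj S v u]| = 2 * #|S :&: pairs W|)%N.
Proof.
move=> sS.
pose r u v := [&& u \in W, v \in W & adj S u v].
have sr : symmetric r by move=> u v; rewrite /r andbCA /adj eq_sym orbC.
have ir : irreflexive r by move=> u; rewrite /r /adj eqxx !andbF.
have -> : S :&: pairs W = [set e in upairs n | r e.1 e.2].
  apply/setP=> -[u v]; rewrite !inE /r /= /adj.
  case: ltngtP => uv; rewrite ?andbF //=.
  rewrite -(inj_eq val_inj) neq_ltn uv /=.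
  have -> : ((v, u) \in S) = false.
    by apply/negP => /(subsetP sS); rewrite inE /= ltnNge ltnW.
  by rewrite orbF andbC andbA.
rewrite -(card_sym_rel sr ir) -sum1_card.
rewrite [in RHS](eq_bigl (fun e => (e.1 \in W) && ((e.2 \in W) && adj S e.1 e.2))); last first.
  by move=> e; rewrite inE.
rewrite -(pair_big_dep (mem W) (fun u v => (v \in W) && adj S u v) (fun _ _ => 1%N)) /=.
by apply: eq_bigr => u _; rewrite sum1_card; apply: eq_card => v; rewrite !inE unfold_in.
Qed.

(* Chernoff's bound, summed over all [W]: with more than [4pm] neighbours inside [W] for
   every vertex, [G[W]] has at least [2pm|W|] edges, against [p|W|^2/2] expected. *)
Lemma Pr_dense_spot (m d : nat) : 4 * p * INR m <= INR d ->
  Pr (dense_spot m d) <= exp (INR n * exp (- (p * INR m))) - 1.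
Proof.
move=> hd.
apply: Rle_trans (@union_bound _ _ p01 _ {set 'I_n} (fun W => (W != set0) && (#|W| <= m)%N)
  (fun W S => [forall v in W, (d < #|[set u in W | adj S v u]|)%N])) _.
set x := exp (- (p * INR m)).
have x0 : 0 < x by apply: exp_pos.
apply: (Rle_trans _ (\sum_(W : {set 'I_n} | W != set0) x ^ #|W|)); last first.
  have := sum_pow_subsets 'I_n x; rewrite (bigD1 set0) //= cards0 /= card_ord => h.
  apply: (Rplus_le_reg_l 1); apply: (Rle_trans _ _ _ (Req_le _ _ h)).
  have : (1 + x) ^ n <= exp (INR n * x).
    by rewrite -exp_pow; apply: pow_incr; split; [lra | apply: exp_ineq1_le].
  lra.
apply: (Rle_trans _ (\sum_(W : {set 'I_n} | (W != set0) && (#|W| <= m)%N) x ^ #|W|)); last first.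
  by apply: ler_rsum_pred => [W /andP[]//|W _]; apply/Rlt_le/pow_lt.
apply: ler_rsum => W /andP[W0 Wm].
have Wm' : INR #|W| <= INR m by apply/le_INR/leP.
have w0 : 0 <= INR #|W| by apply: pos_INR.
(* Markov's inequality for [exp] of the number of edges inside [W], which is at least [#|W| d / 2].
   The exponent becomes at most [- 2 p m #|W| + p #|W|^2], hence at most [- p m #|W|]. *)
apply: (Rle_trans _ (Ex p (upairs n) (fun S =>
    exp (- (INR #|W| * (INR d / 2))) * exp 1 ^ #|S :&: pairs W|))).
  apply: Ex_le => // S sS; rewrite /indic; case: ifP => [/forall_inP h|_]; last first.
    by apply: Rmult_le_pos; [exact/Rlt_le/exp_pos | apply/pow_le/Rlt_le/exp_pos].
  rewrite exp_pow -exp_plus; apply: (Rle_trans _ (exp 0)); first by rewrite exp_0; lra.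
  apply: exp_le.
  have : (#|W| * d <= 2 * #|S :&: pairs W|)%N.
    rewrite -sum_degrees // -sum_nat_const; apply: leq_sum => v vW; exact/ltnW/h.
  move/leP/le_INR; rewrite !mult_INR [INR 2]/=; lra.
rewrite ExZ Ex_expI ?pairs_sub // card_pairs.
have e3 := exp_le_3.
apply: (Rle_trans _ (exp (- (INR #|W| * (INR d / 2))) * exp (INR 'C(#|W|, 2) * (2 * p)))).
  apply: Rmult_le_compat_l; first exact/Rlt_le/exp_pos.
  rewrite -exp_pow; apply: pow_incr; have := exp_ineq1_le 1; have := exp_ineq1_le (2 * p); split; nra.
have hc : 2 * INR 'C(#|W|, 2) <= INR #|W| * INR #|W|.
  rewrite -mult_INR -[2]/(INR 2) -mult_INR; apply/le_INR/leP.
  rewrite !multE bin2 mul2n; apply: (@leq_trans (#|W| * #|W|.-1)%N).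
    by rewrite -[leqRHS]odd_double_half leq_addl.
  by rewrite leq_mul2l leq_pred orbT.
rewrite -exp_plus /x exp_pow; apply: exp_le.
have := Rmult_le_compat_l (INR #|W|) _ _ w0 hd.
have := Rmult_le_compat_l p _ _ (proj1 p01) hc.
have := Rmult_le_compat_l (p * INR #|W|) _ _ (Rmult_le_pos _ _ (proj1 p01) w0) Wm'.
lra.
Qed.

End BadEvents.

(** * Greedy construction of tone colorings *)

Section GreedyColoring.
Variables (T : finType) (r : rel T).
Hypothesis r_sym : symmetric r.
Implicit Types (U W I : {set T}).

Definition proper_on (C : eqType) (U : {set T}) (c : T -> C) : Prop :=
  {in U &, forall u v, u != v -> r u v -> c u != c v}.

Definition low_degree (d : nat) (W : {set T}) : Prop :=
  exists2 v, v \in W & (#|[set u in W | (u != v) && r v u]| <= d)%N.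

Lemma degenerate_coloring d U :
  (forall W, W \subset U -> W != set0 -> low_degree d W) ->
  exists c : T -> 'I_d.+1, proper_on U c.
Proof.
elim: {U}#|U| {-2}U (erefl #|U|) => [|s IH] U cU hU.
  by exists (fun=> ord0) => u v; move/eqP: cU; rewrite cards_eq0 => /eqP->; rewrite inE.
have [|v vU dv] := hU U (subxx _); first by rewrite -cards_eq0 cU.
have cU' : #|U :\ v| = s by have := cardsD1 v U; rewrite cU vU add1n => -[].
have [|c hc] := IH _ cU'.
  by move=> W sW; apply: hU; apply: subset_trans sW (subsetDl _ _).
have [x xN] : exists x, x \notin [set c u | u in [set u in U | (u != v) && r v u]].
  apply/existsP; rewrite -negb_forall; apply/negP=> /forallP h.
  have : (#|'I_d.+1| <= d)%N.
    rewrite -cardsT; apply: leq_trans dv; apply: leq_trans (leq_imset_card c _).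
    by apply: subset_leq_card; apply/subsetP=> y _; apply: h.
  by rewrite card_ord ltnn.
have xP u : u \in U -> u != v -> r v u -> c u != x.
  move=> uU uv ruv; apply: contraNneq xN => <-; apply: imset_f.
  by rewrite inE uU uv.
exists (fun u => if u == v then x else c u) => u w uU wU uw ruw.
case: (eqVneq u v) => [uv|uv]; case: (eqVneq w v) => [wv|wv].
- by rewrite uv wv eqxx in uw.
- by rewrite eq_sym; apply: xP => //; rewrite -uv.
- by apply: xP => //; rewrite r_sym -wv.
- by apply: hc => //; rewrite !inE ?uv ?wv.
Qed.

(** Every removed [k]-set receives its own colour, and [N] counts these sets; once fewer than [m]
    vertices remain, the degenerate rest uses the lowest [d + 1] colours. *)
Lemma greedy_coloring k m d U : (0 < k)%N ->
  (forall W, (m <= #|W|)%N -> exists I : {set _}, [/\ I \subset W, #|I| = k &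
     {in I &, forall u v, u != v -> ~~ r u v}]) ->
  (forall W, W != set0 -> (#|W| <= m)%N -> low_degree d W) ->
  exists (c : T -> nat) (N : nat), [/\ (N * k <= #|U|)%N,
    forall v, (c v < N + d.+1)%N & proper_on U c].
Proof.
move=> k0 hI hd; have [s] := ubnP #|U|; elim: s U => // s IH U cU.
case: (leqP m #|U|) => mU; last first.
  have [|c hc] := @degenerate_coloring d U.
    move=> W sW W0; apply: hd => //; apply: leq_trans (ltnW mU).
    exact: subset_leq_card.
  by exists (fun v => val (c v)), 0%N; split=> // v; rewrite ltn_ord.
have [I [sI cI fI]] := hI _ mU.
have cUI : (#|U :\: I| + k = #|U|)%N by rewrite cardsDS // cI subnK // -cI subset_leq_card.
have [|c [N [hN cN hc]]] := IH (U :\: I).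
  by apply: leq_trans (_ : _ <= #|U|)%N _ => //; rewrite -cUI -addn1 leq_add2l.
exists (fun v => if v \in I then (N + d.+1)%N else c v), N.+1; split=> [|v|u v uU vU uv ruv].
- by rewrite mulSn addnC -cUI leq_add2r.
- by case: ifP => _; rewrite addSn ltnS // ltnW.
case: ifP => uI; case: ifP => vI.
- by have := fI u v uI vI uv; rewrite ruv.
- by rewrite eq_sym neq_ltn cN.
- by rewrite neq_ltn cN.
- by apply: hc => //; rewrite inE ?uI ?vI.
Qed.

End GreedyColoring.

(** * Chromatic and tone chromatic numbers from successive proper colourings *)

Section ToneColoring.
Variables (n : nat) (S : {set 'I_n * 'I_n}).
Hypothesis sS : S \subset upairs n.

Lemma within1 u v : within S 1 u v = (u == v) || adj S u v.
Proof.
congr (_ || _); apply/existsP/idP => [[w /andP[h /eqP<-]] //|h].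
by exists v; rewrite h eqxx.
Qed.

Lemma within_mono i j u v : (i <= j)%N -> within S i u v -> within S j u v.
Proof. by move/subnK => <-; elim: (j - i)%N => // l IH /IH h; rewrite addSn /= h. Qed.

Variable a : nat.
Hypothesis indep_le : forall A, indep S A -> (#|A| <= a)%N.

Lemma class_le (C : eqType) (c : 'I_n -> C) x :
  (forall u v, adj S u v -> c u != c v) -> (#|[set v | c v == x]| <= a)%N.
Proof.
move=> hc; apply: indep_le; apply/(indepP _ sS) => u v; rewrite !inE => /eqP cu /eqP cv.
by apply/negP=> /hc; rewrite cu cv eqxx.
Qed.

Lemma card_le_chi : (n <= a * chi S)%N.
Proof.
rewrite /chi; case: ex_minnP => k /existsP[f /forallP hf] _.
have {}hf u v : adj S u v -> f u != f v by move/implyP: (forallP (hf u) v).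
rewrite -{1}(card_ord n) -sum1_card (partition_big f xpredT) //= mulnC -[in leqRHS](card_ord k).
rewrite -sum_nat_const; apply: leq_sum => x _; rewrite sum1_card.
by rewrite -[leqLHS]cardsE; apply: class_le.
Qed.

Lemma card_le_tau t : (t * n <= a * tau t S)%N.
Proof.
rewrite /tau; case: ex_minnP => k /existsP[f /andP[/forallP cf /forallP hf]] _.
have -> : (t * n = \sum_(v : 'I_n) \sum_(x | x \in f v) 1)%N.
  rewrite (eq_bigr (fun=> t)) => [|v _]; last by rewrite sum1_card (eqP (cf v)).
  by rewrite big_const_ord iter_addn_0.
rewrite (exchange_big_dep xpredT) //= mulnC -[in leqRHS](card_ord k) -sum_nat_const.
apply: leq_sum => x _; rewrite sum1_card -[leqLHS]cardsE.
apply: indep_le; apply/(indepP _ sS) => u v; rewrite !inE => fu fv.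
apply/negP=> auv; have uv : u != v by case/andP: auv.
have := forallP (hf u) v; rewrite uv /= /lt_dist => /negP; apply.
apply: (@within_mono 1); last by rewrite within1 auv orbT.
by apply/card_gt0P; exists x; rewrite inE; apply/andP.
Qed.

Lemma chi_le N (c : 'I_n -> nat) : (forall v, (c v < N)%N) ->
  (forall u v, adj S u v -> c u != c v) -> (chi S <= N)%N.
Proof.
move=> cN hc; rewrite /chi; case: ex_minnP => k _; apply.
apply/existsP; exists [ffun v => Ordinal (cN v)].
by apply/forallP=> u; apply/forallP=> v; apply/implyP=> /hc; rewrite !ffunE.
Qed.

(* Give [v] the label [(i, c i v)] in the [i]-th palette. *)
Lemma tau_le t N (c : nat -> 'I_n -> nat) :
  (forall i v, (i < t)%N -> (c i v < N)%N) ->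
  (forall i u v, (i < t)%N -> adj S u v -> c i u != c i v) ->
  (forall i j u v, (i < t)%N -> (j < t)%N -> i != j -> u != v ->
     c i u = c i v -> c j u != c j v) ->
  (tau t S <= t * N)%N.
Proof.
move=> cN hadj hpair.
have -> : (t * N)%N = #|{: 'I_t * 'I_N}| by rewrite card_prod !card_ord.
rewrite /tau; case: ex_minnP => k _; apply.
pose lab v (i : 'I_t) := enum_rank (i, Ordinal (cN i v (ltn_ord i))).
have labE u v i j : lab u i = lab v j -> i = j /\ c i u = c i v.
  by move/enum_rank_inj => [-> e]; rewrite e.
apply/existsP; exists [ffun v => [set lab v i | i : 'I_t]].
apply/andP; split.
  apply/forallP=> v; rewrite ffunE card_imset ?card_ord //.
  by move=> i j /labE[].
apply/forallP=> u; apply/forallP=> v; apply/implyP=> uv; rewrite !ffunE /lt_dist.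
set X := _ :&: _.
have XP x : x \in X -> exists2 i, x = lab u i & c i u = c i v.
  rewrite inE => /andP[/imsetP[i _ ->] /imsetP[j _ /labE[_ e]]]; by exists i.
case auv: (adj S u v).
  suff -> : X = set0 by rewrite cards0.
  apply/eqP; rewrite -subset0; apply/subsetP=> x /XP[i _ e].
  by have := hadj i u v (ltn_ord i) auv; rewrite e eqxx.
have : (#|X| <= 1)%N.
  apply/card_le1_eqP=> x y /XP[i -> ei] /XP[j -> ej].
  case: (eqVneq i j) => [->|ij] //.
  by have := hpair i j u v (ltn_ord i) (ltn_ord j) ij uv ei; rewrite ej eqxx.
(* Distinct non-adjacent vertices are at distance at least 2, so one common label is permitted. *)
move=> X1; apply/negP=> /(within_mono X1); rewrite within1 auv orbF.
by apply/negP.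
Qed.

Section Rounds.
Variables (t k m d : nat).
Hypotheses (t0 : (0 < t)%N) (k0 : (0 < k)%N).
Hypothesis not_stuck : ~~ stuck t k m a S.
Hypothesis not_dense : ~~ dense_spot m d S.
(** Colours of one round: the removed [k]-sets, then the rest, where a low-degree vertex has at most
    [d] neighbours in the graph and at most [t * a] clashes with earlier colourings. The bound
    [N <= n] lets every colouring be stored with values in ['I_n], the finite type over which
    [stuck] quantifies. *)
Let N := (n %/ k + (d + t * a).+1)%N.
Hypothesis Nn : (N <= n)%N.

Lemma adj_sym : symmetric (adj S).
Proof. by move=> u v; rewrite /adj eq_sym orbC. Qed.

Lemma clash_sym (c : {ffun 'I_t -> {ffun 'I_n -> 'I_n}}) : symmetric (clash c).
Proof. by move=> u v; apply: eq_existsb => i; rewrite eq_sym. Qed.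

Lemma next_round (c : {ffun 'I_t -> {ffun 'I_n -> 'I_n}}) : small_classes a c ->
  exists c' : {ffun 'I_n -> 'I_n}, (forall v, (c' v < N)%N) /\
    (forall u v, u != v -> adj S u v || clash c u v -> c' u != c' v).
Proof.
move=> hc; pose r : rel 'I_n := fun u v => adj S u v || clash c u v.
have r_sym : symmetric r by move=> u v; rewrite /r adj_sym clash_sym.
have hI (W : {set 'I_n}) : (m <= #|W|)%N -> exists I : {set _}, [/\ I \subset W, #|I| = k &
     {in I &, forall u v, u != v -> ~~ r u v}].
  (* [stuck] concerns sets of exactly [m] vertices, so [W] is first cut down to one. *)
  move=> mW; have [U sUW cU] := subset_of_card mW.
  move: not_stuck; rewrite negb_exists => /forallP/(_ (U, c)) /=.
  rewrite cU eqxx hc /= => /forall_inPn[I]; rewrite inE => /and3P[sI /eqP cI fI].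
  rewrite negbK => /(indepP _ sS) iI; exists I; split=> //; first exact: subset_trans sI sUW.
  move=> u v uI vI uv; rewrite negb_or iI //=.
  by move/forall_inP: fI => /(_ u uI)/forall_inP/(_ v vI); rewrite uv.
have hd (W : {set 'I_n}) : W != set0 -> (#|W| <= m)%N -> low_degree r (d + t * a) W.
  move=> W0 Wm; move: not_dense; rewrite negb_exists => /forallP/(_ W).
  rewrite W0 Wm /= => /forall_inPn[v vW]; rewrite -leqNgt => dv; exists v => //.
  apply: leq_trans (leq_add dv (clash_degree v hc)).
  apply: leq_trans (leq_card_setU _ _); apply: subset_leq_card.
  apply/subsetP=> u; rewrite !inE eq_sym => /and3P[-> -> /orP[]->] //.
  by rewrite orbT.
have [c' [M [hM cM pc]]] := greedy_coloring r_sym [set: 'I_n] k0 hI hd.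
have cN v : (c' v < N)%N.
  apply: leq_trans (cM v) _; rewrite leq_add2r leq_divRL //.
  by move: hM; rewrite cardsT card_ord.
exists [ffun v => Ordinal (leq_trans (cN v) Nn)]; split=> [v|u v uv ruv]; rewrite !ffunE ?cN //.
by have := pc u v (in_setT _) (in_setT _) uv ruv; apply: contra => /eqP[->].
Qed.

(* Slots without a coloring yet are filled with the identity, which never clashes. *)
Lemma rounds j : (j <= t)%N -> exists c : nat -> {ffun 'I_n -> 'I_n},
  [/\ forall i u v, adj S u v -> c i u != c i v,
      forall i v, (i < j)%N -> (c i v < N)%N &
      forall i i' u v, (i < j)%N -> (i' < j)%N -> i != i' -> u != v ->
        c i u = c i v -> c i' u != c i' v].
Proof.
elim: j => [_|j IH jt].
  by exists (fun=> [ffun v => v]); split=> // _ u v /andP[uv _]; rewrite !ffunE.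
have [c [c_adj cN c_pair]] := IH (ltnW jt).
pose F : {ffun 'I_t -> {ffun 'I_n -> 'I_n}} :=
  [ffun i : 'I_t => if (i < j)%N then c i else [ffun v => v]].
have [|c' [c'N hc']] := @next_round F.
  (* Every slot, the identity included, holds a proper colouring of the graph, so its classes are
     independent and have at most [a] elements. *)
  apply/forallP=> i; apply/forallP=> x; apply: class_le => u v auv; rewrite !ffunE.
  case: ifP => _; first exact: c_adj.
  by rewrite !ffunE; case/andP: auv.
have c'_sep i u v : (i < j)%N -> u != v -> c i u = c i v -> c' u != c' v.
  move=> ij uv e; apply: hc' => //; apply/orP; right; apply/existsP.
  by exists (Ordinal (ltn_trans ij jt)); rewrite !ffunE /= ij e.
exists (fun i => if i == j then c' else c i); split=> [i u v auv|i v|i i' u v].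
- case: ifP => _; last exact: c_adj.
  by apply: hc'; rewrite ?auv //; case/andP: auv.
- rewrite ltnS leq_eqVlt; case: eqVneq => //= _; exact: cN.
rewrite !ltnS (leq_eqVlt i) (leq_eqVlt i').
case: (eqVneq i j) => [->|ij] /=; case: (eqVneq i' j) => [->|i'j] //= hi hi' ii' uv.
- by move=> e; apply: contraPneq e => e; apply/eqP; apply: c'_sep e.
- exact: c'_sep.
- exact: c_pair.
Qed.

Lemma chi_tau_bounds :
  [/\ (n <= a * chi S)%N, (t * n <= a * tau t S)%N, (chi S <= N)%N & (tau t S <= t * N)%N].
Proof.
have [c [c_adj cN c_pair]] := rounds (leqnn t).
split; [exact: card_le_chi | exact: card_le_tau | |].
  by apply: (@chi_le N (fun v => c 0%N v)) => [v|u v auv]; [exact: cN | exact: c_adj].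
apply: (@tau_le t N (fun i v => c i v)) => [i v|i u v _|i j u v it jt ij uv e].
- exact: cN.
- exact: c_adj.
- by apply: (c_pair i j) => //; apply: val_inj.
Qed.

End Rounds.
End ToneColoring.

(** * Asymptotics *)

Lemma nat_floor (x : R) : 0 <= x -> exists k : nat, INR k <= x < INR k + 1.
Proof.
move=> x0; have [h1 h2] := base_Int_part x.
have h3 : (-1 < Int_part x)%Z by apply: lt_IZR; lra.
exists (Z.to_nat (Int_part x)); rewrite INR_IZR_INZ Z2Nat.id; [lra | lia].
Qed.

(* Here [s] stands for [sqrt (ln n)], [A] for a bound on [1 / (1 - p)] and [g] for the relative
   error.  With [b = exp beta = 1 / (1 - p)], [ell] is [2 log_b (n p)]; [h] is [sqrt n].  The lower
   bounds on [s] collect all that is needed of "n large". *)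
Section Asymptotics.
Variables (n t : nat) (p A g s : R).
Hypotheses (s1 : 1 <= s) (nE : INR n = exp (s * s)).
Hypotheses (p0 : 0 < p) (p1 : p < 1) (A1 : 1 <= A) (Ap : / A <= 1 - p).
Hypothesis np4 : s ^ 18 <= INR n * p ^ 4.
Hypothesis g0 : 0 < g <= / 4.
Hypothesis t0 : 1 <= INR t.
(** [s_A] makes [g * ell] at least 64, so that rounding is harmless; [s_tA] lets Janson's exponent
    beat the union bound; [s_t] makes the leftover colours a fraction [g] of the total; [s_g] lets
    [exp (g s^2 / 4)] absorb powers of [s]. *)
Hypotheses (s_A : 64 * A / g <= s) (s_tA : 4096 * A * (INR t + 2) <= s)
  (s_t : 64 * INR t + 24 + 16 * INR t <= s * g) (s_g : 221184 <= s * g ^ 3).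

Let beta := - ln (1 - p).
Let Lam := ln (INR n * p).
Let ell := 2 * Lam / beta.
Let h := exp (s * s / 2).

Lemma n_gt0 : 0 < INR n. Proof. rewrite nE; exact: exp_pos. Qed.
Lemma h_gt0 : 0 < h. Proof. exact: exp_pos. Qed.
Lemma h_sqr : h * h = INR n. Proof. by rewrite nE /h -exp_plus; congr exp; field. Qed.

Lemma exp_beta : exp (- beta) = 1 - p.
Proof. by rewrite /beta Ropp_involutive exp_ln //; lra. Qed.

Lemma exp_beta_le : exp beta <= A.
Proof.
have <- : / exp (- beta) = exp beta by rewrite exp_Ropp Rinv_inv.
rewrite exp_beta -[X in _ <= X]Rinv_inv; apply: Rinv_le_contravar => //.
by apply: Rinv_0_lt_compat; lra.
Qed.

(** Above: [beta <= exp beta - 1 = p * exp beta <= A * p]. That [p] stays away from 1 thus makes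
    [beta] and [p] comparable. *)
Lemma beta_bounds : p <= beta <= A * p.
Proof.
split.
  have := exp_ineq1_le (- p) => h1.
  have := ln_le (x := 1 - p) (y := exp (- p)) ltac:(lra) ltac:(lra).
  by rewrite ln_exp /beta; lra.
have e1 := exp_ineq1_le beta; have e2 := exp_beta; have e3 := exp_beta_le.
have e4 : exp beta * exp (- beta) = 1 by rewrite -exp_plus Rplus_opp_r exp_0.
nra.
Qed.

Lemma np_pow_ge (k : nat) : (k <= 4)%N -> s ^ 18 <= INR n * p ^ k.
Proof.
move=> k4; apply: Rle_trans np4 _; apply: Rmult_le_compat_l; first exact/Rlt_le/n_gt0.
rewrite -(subnK k4) pow_add -[X in _ <= X]Rmult_1_l; apply: Rmult_le_compat_r.
  by apply: pow_le; lra.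
by rewrite -[X in _ <= X](pow1 (4 - k)); apply: pow_incr; lra.
Qed.

Lemma pow_s_ge1 (k : nat) : 1 <= s ^ k. Proof. exact: pow_R1_Rle. Qed.

Lemma p2h_ge : s ^ 9 <= p ^ 2 * h.
Proof.
apply: Rsqr_incr_0; last first.
- by apply: Rmult_le_pos; [apply: pow_le; lra | exact/Rlt_le/h_gt0].
- by apply: pow_le; lra.
rewrite /Rsqr; have -> : p ^ 2 * h * (p ^ 2 * h) = INR n * p ^ 4 by rewrite -h_sqr; ring.
have -> : s ^ 9 * s ^ 9 = s ^ 18 by ring.
exact: np4.
Qed.

Lemma exp_Lam : exp Lam = INR n * p.
Proof. by rewrite exp_ln //; apply: Rmult_lt_0_compat => //; exact: n_gt0. Qed.

(** Since [p h >= p^2 h >= 1], the product [n p = h * (p h)] lies between [sqrt n] and [n]. *)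
Lemma Lam_bounds : s * s / 2 <= Lam <= s * s.
Proof.
have n0 := n_gt0; have h0 := h_gt0.
split; last first.
  rewrite -[X in _ <= X]ln_exp -nE; apply: ln_le; first exact: Rmult_lt_0_compat.
  by rewrite -[X in _ <= X]Rmult_1_r; apply: Rmult_le_compat_l; lra.
rewrite -[X in X <= _](ln_exp (s * s / 2)); apply: ln_le => //.
have := p2h_ge; have := pow_s_ge1 9; rewrite -/h -h_sqr => a b.
have : 1 <= p * h by nra.
nra.
Qed.

Lemma ell_bounds : 64 / g <= ell /\ s * s <= ell * (A * p) /\ ell * p <= 2 * (s * s).
Proof.
have [b1 b2] := beta_bounds; have [l1 l2] := Lam_bounds.
have eb : ell * beta = 2 * Lam by rewrite /ell; field; lra.
have l0 : 0 < ell by apply: Rdiv_lt_0_compat; nra.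
have h1 : s * s <= ell * (A * p).
  by apply: (Rle_trans _ (ell * beta)); [lra | apply: Rmult_le_compat_l; lra].
have h2 : ell * p <= 2 * (s * s).
  by apply: (Rle_trans _ (ell * beta)); [apply: Rmult_le_compat_l; lra | lra].
split=> //.
have sA : 64 * A <= s * g.
  have := Rmult_le_compat_r g _ _ ltac:(lra) s_A.
  by have -> : 64 * A / g * g = 64 * A by field; lra.
apply: (Rmult_le_reg_r (A * g)); first nra.
have -> : 64 / g * (A * g) = 64 * A by field; lra.
have : s <= ell * A by nra.
nra.
Qed.

(* [k] is the size of the greedily removed sets, [a] bounds the independence number, and sets of at
   most [m] vertices, the leftovers, induce [d]-degenerate graphs. *)
Section ChosenSizes.
Variables k a m d : nat.
Hypotheses (Hk : (1 - g) * ell - 1 <= INR k <= (1 - g) * ell).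
Hypotheses (Ha : (1 + g) * ell <= INR a <= (1 + g) * ell + 1).
Hypotheses (Hm : INR n <= 2 * s ^ 3 * INR m) (Hm' : INR m * s ^ 3 <= INR n).
Hypotheses (Hd : 4 * p * INR m <= INR d <= 4 * p * INR m + 1).

Lemma ell_ge : 64 <= g * ell /\ 256 <= ell.
Proof.
have [h1 _] := ell_bounds.
have : 64 <= g * ell.
  by have := Rmult_le_compat_r g _ _ ltac:(lra) h1; rewrite (_ : 64 / g * g = 64); [lra | field; lra].
split=> //; nra.
Qed.

Lemma k_bounds : ell / 2 <= INR k <= ell /\ INR k * p <= 2 * (s * s).
Proof.
have [h1 h2] := ell_ge; have [_ [_ h3]] := ell_bounds.
have : INR k <= ell by nra.
split; [split => //; nra | nra].
Qed.

Lemma a_bounds : ell <= INR a <= 2 * ell /\ INR a * p <= 4 * (s * s).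
Proof.
have [h1 h2] := ell_ge; have [_ [_ h3]] := ell_bounds.
have : INR a <= 2 * ell by nra.
split; [split => //; nra | nra].
Qed.

Lemma m_gt0 : 0 < INR m.
Proof.
have n0 := n_gt0; have s3 := pow_s_ge1 3.
case: (Rle_lt_dec (INR m) 0) => // hm; have := Rmult_le_compat_l (2 * s ^ 3) _ _ ltac:(lra) hm; lra.
Qed.

(** From [k <= 2 s^2 / p] and [p^2 h >= s^9] follows [k^2 <= 4 h / s^5], while [m >= h^2 / (2 s^3)].
    This makes [k^2 / m] at most [8 / (s^2 sqrt n)], which controls the decay of Janson's sum. *)
Lemma k2h_le_m : INR k ^ 2 * (s * s) * h <= 8 * INR m.
Proof.
have [[k1 k2] k3] := k_bounds; have h0 := h_gt0; have m0 := m_gt0.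
have k0 : 0 <= INR k by exact: pos_INR.
have e1 : INR k ^ 2 * p ^ 2 <= 4 * s ^ 4.
  rewrite -Rpow_mult_distr (_ : 4 * s ^ 4 = (2 * (s * s)) ^ 2); last by ring.
  by apply: pow_incr; split=> //; apply: Rmult_le_pos; lra.
have e2 : INR k ^ 2 * s ^ 9 <= 4 * s ^ 4 * h.
  apply: (Rle_trans _ (INR k ^ 2 * (p ^ 2 * h))); first by apply: Rmult_le_compat_l p2h_ge; exact: pow_le.
  by rewrite -Rmult_assoc; apply: Rmult_le_compat_r; lra.
have e3 : INR k ^ 2 * s ^ 5 <= 4 * h.
  by apply: (Rmult_le_reg_l (s ^ 4)); [have := pow_s_ge1 4; lra | nra].
have e4 : INR k ^ 2 * s ^ 5 * h <= 8 * s ^ 3 * INR m.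
  apply: (Rle_trans _ (4 * h * h)); first by apply: Rmult_le_compat_r => //; lra.
  by rewrite Rmult_assoc h_sqr; lra.
by apply: (Rmult_le_reg_l (s ^ 3)); [have := pow_s_ge1 3; lra | nra].
Qed.

(** What [card_free_sets] asks for. Here [a k^2] is of order at most [s^6 / p^3] and [m] at least
    [n / (2 s^3)], so a lower bound on [n p^3] is enough. *)
Lemma conflict_bound : (2 * (t * a) * k ^ 2 <= m)%N.
Proof.
apply/leP/INR_le; rewrite !mult_INR [INR 2]/=.
have [[k1 k2] k3] := k_bounds; have [[a1 a2] a3] := a_bounds.
have k0 : 0 <= INR k by exact: pos_INR.
have a0 : 0 <= INR a by exact: pos_INR.
have m0 := m_gt0; have s3 := pow_s_ge1 3; have s6 := pow_s_ge1 6.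
have e1 : INR k ^ 2 * p ^ 2 <= 4 * s ^ 4.
  rewrite -Rpow_mult_distr (_ : 4 * s ^ 4 = (2 * (s * s)) ^ 2); last by ring.
  by apply: pow_incr; split=> //; apply: Rmult_le_pos; lra.
have e2 : INR a * p * (INR k ^ 2 * p ^ 2) <= 4 * (s * s) * (4 * s ^ 4).
  by apply: Rmult_le_compat => //; apply: Rmult_le_pos; try lra; apply: pow_le; lra.
have st : 64 * INR t <= s by nra.
have e3 : 64 * INR t * s ^ 9 <= INR n * p ^ 3.
  apply: Rle_trans (np_pow_ge (k := 3) isT).
  apply: (Rle_trans _ (s * s ^ 9)); first by apply: Rmult_le_compat_r => //; have := pow_s_ge1 9; lra.
  have -> : s ^ 18 = s * s ^ 9 * s ^ 8 by ring.
  have := pow_s_ge1 8; have := pow_s_ge1 9; nra.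
have p3 : 0 < p ^ 3 by exact: pow_lt.
apply: (Rmult_le_reg_r (p ^ 3)) => //.
apply: (Rmult_le_reg_l (2 * s ^ 3)); first lra.
have : 2 * s ^ 3 * INR m * p ^ 3 >= INR n * p ^ 3 by apply/Rle_ge/Rmult_le_compat_r; lra.
have : 2 * s ^ 3 * (2 * INR t) * (INR a * p * (INR k ^ 2 * p ^ 2)) <=
       2 * s ^ 3 * (2 * INR t) * (4 * (s * s) * (4 * s ^ 4)).
  by apply: Rmult_le_compat_l => //; apply: Rmult_le_pos; lra.
have -> : 2 * s ^ 3 * (2 * INR t) * (4 * (s * s) * (4 * s ^ 4)) = 64 * INR t * s ^ 9 by ring.
have -> : 2 * s ^ 3 * (2 * INR t) * (INR a * p * (INR k ^ 2 * p ^ 2)) =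
  2 * s ^ 3 * ((1 + 1) * (INR t * INR a) * (INR k * INR k) * p ^ 3) by ring.
lra.
Qed.

Lemma k_gt1 : (1 < k)%N.
Proof.
apply/leP/INR_le; have [[h1 _] _] := k_bounds; have [_ h2] := ell_ge.
rewrite [INR 2]/=; lra.
Qed.

Lemma a_gt0 : (0 < a)%N.
Proof. by apply/leP/INR_le; have [[h1 _] _] := a_bounds; have [_ h2] := ell_ge; rewrite [INR 1]/=; lra. Qed.

Lemma t_gt0 : (0 < t)%N.
Proof. by apply/leP/INR_le; rewrite [INR 1]/=; lra. Qed.

Lemma k_le_m : (k <= m)%N.
Proof.
apply: leq_trans conflict_bound; rewrite expnS expn1 mulnA.
by rewrite leq_pmull // !muln_gt0 t_gt0 a_gt0 (ltnW k_gt1).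
Qed.

Lemma s5_le_exp : 128 * s ^ 5 <= exp (g * (s * s) / 4).
Proof.
(* The cube of [y] is at least [128 s^5] exactly when [s g^3 >= 128 * 12^3 = 221184]. *)
set y := g * (s * s) / 12.
have -> : g * (s * s) / 4 = INR 3 * y by rewrite /y /=; field.
rewrite -exp_pow; have y0 : 0 <= y by rewrite /y; nra.
apply: (Rle_trans _ (y ^ 3)); last by apply: pow_incr; have := exp_ineq1_le y; lra.
have -> : y ^ 3 = s * g ^ 3 * (s ^ 5 / 1728) by rewrite /y; field.
have s5 := pow_s_ge1 5.
apply: (Rle_trans _ (221184 * (s ^ 5 / 1728))); first lra.
apply: Rmult_le_compat_r => //; lra.
Qed.

(* For [4 i <= k] the estimate ['C(k, i) <= k ^ i] shows that the terms decay geometrically from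
   [i = 2] on; for [4 i > k] the estimate ['C(k, i) <= 2 ^ k <= 16 ^ i] makes them at most
   [n^(-2) 2^(-i)]. *)
Lemma janson_term (i : nat) : (1 < i)%N -> (i <= k)%N ->
  INR 'C(k, i) * (INR k / INR m) ^ i / (1 - p) ^ 'C(i, 2) <=
  4 * A * (INR k ^ 4 / INR m ^ 2) * (1 / 2) ^ i.
Proof.
move=> i2 ik; have m0 := m_gt0; have [[k1 k2] k3] := k_bounds; have [_ ell0] := ell_ge.
have k0 : 0 < INR k by lra.
have i2R : 2 <= INR i by have /leP/le_INR := i2; rewrite [INR 2]/=.
have ikR : INR i <= INR k by apply/le_INR/leP.
have [b1 b2] := beta_bounds; have b0 : 0 < beta by lra.
have [L1 L2] := Lam_bounds.
have km0 : 0 < INR k / INR m by exact: Rdiv_lt_0_compat.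
have bk : beta * INR k <= 2 * ((1 - g) * Lam).
  apply: (Rle_trans _ (beta * ((1 - g) * ell))); first by apply: Rmult_le_compat_l; lra.
  by apply: Req_le; rewrite /ell; field; lra.
have bL : beta * INR k <= 2 * (s * s) by nra.
rewrite /Rdiv -exp_beta exp_pow -exp_Ropp INR_bin2.
have -> : - (INR i * (INR i - 1) / 2 * - beta) = INR i * (beta * (INR i - 1) / 2) by field.
case: (leqP (4 * i) k) => ik4.
  have ik4R : 4 * INR i <= INR k.
    by have /leP/le_INR := ik4; rewrite mult_INR [INR 4]/=; lra.
  have [j ij] : exists j, i = j.+2 by case: (i) i2 => [|[|j]] // _; exists j.
  rewrite ij in i2R ikR ik4R *; rewrite !S_INR in i2R ikR ik4R *.
  set Y := INR k * (INR k * / INR m).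
  have Y0 : 0 < Y by apply: Rmult_lt_0_compat.
  (* [r] is [n^(1/4)]. As [beta k <= 2 ln n] and [4 i <= k], the factor [exp (beta (i - 1) / 2)] is
     at most [r], whereas [Y = k^2 / m] is at most [8 / (s^2 r^2)]. *)
  set r := exp (s * s / 4).
  have r1 : 1 <= r by have := exp_ineq1_le (s * s / 4); rewrite -/r; nra.
  have hr : h = r * r by rewrite /h /r -exp_plus; congr exp; field.
  have Yh : Y * (s * s) * (r * r) <= 8.
    rewrite -hr; apply: (Rmult_le_reg_r (INR m)) => //; apply: Rle_trans k2h_le_m.
    by apply: Req_le; rewrite /Y; field; lra.
  have YAr : Y * (A * r) <= 1 / 2.
    have sA : 16 * A <= s by nra.
    apply: (Rmult_le_reg_r (s * s * r)); first nra.
    have -> : Y * (A * r) * (s * s * r) = A * (Y * (s * s) * (r * r)) by ring.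
    apply: (Rle_trans _ (A * 8)); first by apply: Rmult_le_compat_l; lra.
    have : s * 1 <= s * (s * r) by apply: Rmult_le_compat_l; nra.
    lra.
  have eY : Y * exp (beta + beta * (INR j + 1) / 2) <= 1 / 2.
    apply: Rle_trans YAr; apply: Rmult_le_compat_l; first lra.
    rewrite exp_plus; apply: Rmult_le_compat; try exact/Rlt_le/exp_pos; first exact: exp_beta_le.
    apply: exp_le; have : beta * (4 * (INR j + 1)) <= beta * INR k by apply: Rmult_le_compat_l; lra.
    lra.
  apply: (Rle_trans _ (INR k ^ j.+2 * (INR k * / INR m) ^ j.+2 *
      exp ((INR j + 1 + 1) * (beta * (INR j + 1 + 1 - 1) / 2)))).
    apply: Rmult_le_compat_r; first exact/Rlt_le/exp_pos.
    apply: Rmult_le_compat_r; first exact/Rlt_le/pow_lt.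
    by rewrite -INR_expn; apply/le_INR/leP/bin_le_exp.
  rewrite -Rpow_mult_distr -/Y.
  have -> : Y ^ j.+2 * exp ((INR j + 1 + 1) * (beta * (INR j + 1 + 1 - 1) / 2)) =
      Y ^ 2 * exp beta * (Y * exp (beta + beta * (INR j + 1) / 2)) ^ j.
    rewrite Rpow_mult_distr exp_pow (_ : (INR j + 1 + 1) * (beta * (INR j + 1 + 1 - 1) / 2) =
      beta + INR j * (beta + beta * (INR j + 1) / 2)); last by field.
    by rewrite exp_plus /=; ring.
  apply: (Rle_trans _ (Y ^ 2 * A * (1 / 2) ^ j)).
    apply: Rmult_le_compat; first by apply: Rmult_le_pos; [apply: pow_le; lra | exact/Rlt_le/exp_pos].
    - by apply: pow_le; apply: Rmult_le_pos; [lra | exact/Rlt_le/exp_pos].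
    - by apply: Rmult_le_compat_l; [apply: pow_le; lra | exact: exp_beta_le].
    - apply: pow_incr; split=> //; apply: Rmult_le_pos; [lra | exact/Rlt_le/exp_pos].
  by apply: Req_le; rewrite /Y -/(1 / 2) /=; field; lra.
have ik4R : INR k <= 4 * INR i.
  by have /ltnW/leP/le_INR := ik4; rewrite mult_INR [INR 4]/=; lra.
have e1 : INR 'C(k, i) <= 16 ^ i.
  have := bin_pow_le k i (x := 1) ltac:(lra); rewrite pow1 Rmult_1_r => e.
  apply: (Rle_trans _ _ _ e); rewrite (_ : 16 = 2 ^ 4); last by ring.
  by rewrite -pow_mult (_ : 1 + 1 = 2) //; apply: Rle_pow; [lra | apply/leP/ltnW].
set E := exp (beta * (INR i - 1) / 2).
have E0 : 0 < E by apply: exp_pos.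
set x := 16 * (INR k * / INR m) * E.
have x0 : 0 < x by apply: Rmult_lt_0_compat => //; lra.
(* Here the slack [g] in [k] pays: [E <= (n p)^(1 - g)] and [k / m <= 4 s^5 / (n p)], which leaves
   [(n p)^(- g / 2)]. As [i > k / 4] gives [g i >= 8], the [i]-th power is at most [n^(-2)]. *)
have e2 : 2 * x <= exp (- (g * Lam / 2)).
  have km : INR k * / INR m <= 4 * s ^ 5 * exp (- Lam).
    apply: (Rmult_le_reg_r (INR m * exp Lam)); first by apply: Rmult_lt_0_compat => //; exact: exp_pos.
    have -> : INR k * / INR m * (INR m * exp Lam) = INR k * exp Lam by field; lra.
    have -> : 4 * s ^ 5 * exp (- Lam) * (INR m * exp Lam) = 4 * s ^ 5 * INR m.
      by rewrite exp_Ropp; field; apply/Rgt_not_eq/exp_pos.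
    rewrite exp_Lam.
    apply: (Rle_trans _ (2 * (s * s) * INR n)).
      have -> : INR k * (INR n * p) = INR k * p * INR n by ring.
      by apply: Rmult_le_compat_r; [exact/Rlt_le/n_gt0 | ].
    have -> : 4 * s ^ 5 * INR m = 2 * (s * s) * (2 * s ^ 3 * INR m) by ring.
    by apply: Rmult_le_compat_l => //; nra.
  have EL : E <= exp ((1 - g) * Lam).
    apply: exp_le; have : beta * (INR i - 1) <= beta * INR k by apply: Rmult_le_compat_l; lra.
    lra.
  have s5 := pow_s_ge1 5.
  apply: (Rle_trans _ (128 * s ^ 5 * exp (- Lam) * exp ((1 - g) * Lam))).
    have -> : 2 * x = 32 * (INR k * / INR m) * E by rewrite /x; ring.
    apply: Rmult_le_compat => //; lra.
  rewrite Rmult_assoc -exp_plus.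
  apply: (Rle_trans _ (exp (g * (s * s) / 4) * exp (- Lam + (1 - g) * Lam))).
    by apply: Rmult_le_compat_r s5_le_exp; exact/Rlt_le/exp_pos.
  by rewrite -exp_plus; apply: exp_le; nra.
have e3 : (2 * x) ^ i <= / INR m ^ 2.
  apply: (Rle_trans _ (exp (- (2 * (s * s))))).
    apply: (Rle_trans _ (exp (- (g * Lam / 2)) ^ i)); first by apply: pow_incr; lra.
    rewrite exp_pow; apply: exp_le.
    have gk : 32 <= g * INR k by have [q1 _] := ell_ge; nra.
    have gi : 8 <= g * INR i by nra.
    have : 8 * (s * s / 2) <= g * INR i * Lam by apply: Rmult_le_compat; nra.
    lra.
  have -> : - (2 * (s * s)) = INR 2 * - (s * s) by rewrite [INR 2]/=; ring.
  rewrite -exp_pow exp_Ropp -nE pow_inv; apply: Rinv_le_contravar; first exact: pow_lt.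
  apply: pow_incr; split; first lra.
  by apply: Rle_trans Hm'; have := pow_s_ge1 3; nra.
apply: (Rle_trans _ (x ^ i)).
  rewrite /x (Rpow_mult_distr (16 * _)) (Rpow_mult_distr 16) -exp_pow -/E.
  apply: Rmult_le_compat_r; first exact/Rlt_le/pow_lt.
  by apply: Rmult_le_compat_r => //; exact/Rlt_le/pow_lt.
have -> : x ^ i = (2 * x) ^ i * (1 / 2) ^ i by rewrite -Rpow_mult_distr; congr (_ ^ _); field.
apply: Rmult_le_compat_r; first by apply: pow_le; lra.
apply: (Rle_trans _ _ _ e3).
have m2 : 0 < / INR m ^ 2 by apply/Rinv_0_lt_compat/pow_lt.
have k4 : 1 <= INR k ^ 4 by apply: pow_R1_Rle; lra.
rewrite -Rmult_assoc -[X in X <= _]Rmult_1_l; apply: Rmult_le_compat_r; nra.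
Qed.

Lemma geom_half (j : nat) : \big[Rplus/0]_(i < j) (1 / 2) ^ i <= 2.
Proof.
suff : \big[Rplus/0]_(i < j) (1 / 2) ^ i = 2 - 2 * (1 / 2) ^ j.
  by have : 0 <= (1 / 2) ^ j; [apply: pow_le; lra | lra].
by elim: j => [|j IH]; [rewrite big_ord0 /=; lra | rewrite big_ord_recr /= IH; lra].
Qed.

Lemma janson_sum :
  \big[Rplus/0]_(i < k.+1 | (1 < i)%N)
     (INR 'C(k, i) * (INR k / INR m) ^ i / (1 - p) ^ 'C(i, 2)) <=
  8 * A * (INR k ^ 4 / INR m ^ 2).
Proof.
have m0 := m_gt0.
have c0 : 0 <= 4 * A * (INR k ^ 4 / INR m ^ 2).
  apply: Rmult_le_pos; first lra.
  by apply: Rmult_le_pos; [apply/pow_le/pos_INR | apply/Rlt_le/Rinv_0_lt_compat; exact: pow_lt].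
apply: (Rle_trans _ (\big[Rplus/0]_(i < k.+1) (4 * A * (INR k ^ 4 / INR m ^ 2) * (1 / 2) ^ i))).
  rewrite big_mkcond; apply: ler_rsum => i _; case: ifP => i2.
    by apply: janson_term => //; rewrite -ltnS.
  by apply: Rmult_le_pos => //; apply: pow_le; lra.
rewrite rsumMl; apply: (Rle_trans _ _ _ (Rmult_le_compat_l _ _ _ c0 (geom_half _))); lra.
Qed.

(** With [m >= n / (2 s^3)], [k <= 2 s^2 / p] and [n p^4 >= s^18], the Janson exponent
    [m^2 / (64 A k^4)] is at least [n s^4 / (4096 A)]; the choices contribute only
    [n (1 + t s^2)]. *)
Lemma stuck_bound :
  INR (2 ^ n * (n ^ n) ^ t) * exp (- / (8 * (8 * A * (INR k ^ 4 / INR m ^ 2)))) <= exp (- s).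
Proof.
have m0 := m_gt0; have n0 := n_gt0; have [[k1 k2] k3] := k_bounds; have [_ ell0] := ell_ge.
have k0 : 0 < INR k by lra.
have k4 : 0 < INR k ^ 4 by apply: pow_lt.
have e1 : INR (2 ^ n * (n ^ n) ^ t) <= exp (INR n * (1 + INR t * (s * s))).
  rewrite mult_INR !INR_expn [INR 2]/= nE !exp_pow.
  apply: (Rle_trans _ (exp 1 ^ n * exp (INR t * (INR n * (s * s))))).
    apply: Rmult_le_compat_r; first exact/Rlt_le/exp_pos.
    by apply: pow_incr; have := exp_ineq1_le 1; lra.
  by rewrite exp_pow -exp_plus; apply: Req_le; congr exp; rewrite -nE; ring.
apply: (Rle_trans _ _ _ (Rmult_le_compat_r _ _ _ (Rlt_le _ _ (exp_pos _)) e1)).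
rewrite -exp_plus; apply: exp_le.
have -> : / (8 * (8 * A * (INR k ^ 4 / INR m ^ 2))) = INR m ^ 2 / (64 * A * INR k ^ 4).
  by field; repeat split; apply: Rgt_not_eq; lra.
have e2 : INR n * (s ^ 4 / (4096 * A)) <= INR m ^ 2 / (64 * A * INR k ^ 4).
  apply: (Rmult_le_reg_r (64 * A * INR k ^ 4)); first by apply: Rmult_lt_0_compat; lra.
  have -> : INR m ^ 2 / (64 * A * INR k ^ 4) * (64 * A * INR k ^ 4) = INR m ^ 2.
    by field; split; apply: Rgt_not_eq; lra.
  have -> : INR n * (s ^ 4 / (4096 * A)) * (64 * A * INR k ^ 4) = INR n * s ^ 4 * INR k ^ 4 / 64.
    by field; apply: Rgt_not_eq; lra.
  have p4 : 0 < p ^ 4 by apply: pow_lt.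
  have kp4 : INR k ^ 4 * p ^ 4 <= 16 * s ^ 8.
    rewrite -Rpow_mult_distr (_ : 16 * s ^ 8 = (2 * (s * s)) ^ 4); last by ring.
    by apply: pow_incr; split=> //; apply: Rmult_le_pos; lra.
  have nm : INR n ^ 2 <= 4 * s ^ 6 * INR m ^ 2.
    rewrite (_ : 4 * s ^ 6 * INR m ^ 2 = (2 * s ^ 3 * INR m) ^ 2); last by ring.
    by apply: pow_incr; lra.
  have s6 := pow_s_ge1 6; have s4 := pow_s_ge1 4; have s8 := pow_s_ge1 8.
  apply: (Rmult_le_reg_r (p ^ 4 * (4 * s ^ 6))); first by apply: Rmult_lt_0_compat; lra.
  have -> : INR n * s ^ 4 * INR k ^ 4 / 64 * (p ^ 4 * (4 * s ^ 6)) =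
      INR n * s ^ 10 / 16 * (INR k ^ 4 * p ^ 4) by field.
  apply: (Rle_trans _ (INR n * s ^ 10 / 16 * (16 * s ^ 8))).
    apply: Rmult_le_compat_l => //; have := pow_s_ge1 10; nra.
  have -> : INR n * s ^ 10 / 16 * (16 * s ^ 8) = INR n * s ^ 18 by field.
  apply: (Rle_trans _ (INR n * (INR n * p ^ 4))); first by apply: Rmult_le_compat_l; lra.
  have -> : INR n * (INR n * p ^ 4) = INR n ^ 2 * p ^ 4 by ring.
  have -> : INR m ^ 2 * (p ^ 4 * (4 * s ^ 6)) = 4 * s ^ 6 * INR m ^ 2 * p ^ 4 by ring.
  apply: Rmult_le_compat_r; lra.
have e3 : (INR t + 2) * (s * s) <= s ^ 4 / (4096 * A).
  apply: (Rmult_le_reg_r (4096 * A)); first lra.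
  have -> : s ^ 4 / (4096 * A) * (4096 * A) = s * s * (s * s) by field; lra.
  have -> : (INR t + 2) * (s * s) * (4096 * A) = s * s * (4096 * A * (INR t + 2)) by ring.
  apply: Rmult_le_compat_l; nra.
have ns : 1 <= INR n by rewrite nE; have := exp_ineq1_le (s * s); nra.
have e4 : INR n * ((INR t + 2) * (s * s)) <= INR n * (s ^ 4 / (4096 * A)).
  by apply: Rmult_le_compat_l; lra.
have : 1 * s <= INR n * (s * s) by apply: Rmult_le_compat; nra.
have : INR n * 1 <= INR n * (s * s) by apply: Rmult_le_compat_l; nra.
lra.
Qed.

Lemma exp_small : 3 * A * exp (- (g * (s * s) / 2)) <= exp (- s).
Proof.
have sA : 64 * A <= s * g.
  have := Rmult_le_compat_r g _ _ ltac:(lra) s_A.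
  by have -> : 64 * A / g * g = 64 * A by field; lra.
have e1 : 3 * A <= exp (3 * A) by have := exp_ineq1_le (3 * A); lra.
apply: (Rle_trans _ _ _ (Rmult_le_compat_r _ _ _ (Rlt_le _ _ (exp_pos _)) e1)).
rewrite -exp_plus; apply: exp_le; nra.
Qed.

(** The left side is at most [X ^ a.+1]. Since [a] exceeds [ell], [n / a.+1 <= A n p], so
    [X <= 3 A (n p)^(- g)]; as [X <= 1], one of the [a.+1] factors already suffices. *)
Lemma large_indep_bound : INR 'C(n, a.+1) * (1 - p) ^ 'C(a.+1, 2) <= exp (- s).
Proof.
have n0 := n_gt0; have [[a1 a2] a3] := a_bounds; have [_ ell0] := ell_ge.
have [b1 b2] := beta_bounds; have b0 : 0 < beta by lra.
have [L1 L2] := Lam_bounds; have [_ [l1 _]] := ell_bounds.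
have S0 : 0 < INR a.+1 by rewrite S_INR; lra.
set X := exp 1 * (INR n / INR a.+1) * exp (- (beta * INR a / 2)).
have nS0 : 0 < INR n / INR a.+1 by exact: Rdiv_lt_0_compat.
have X0 : 0 < X by apply: Rmult_lt_0_compat; [apply: Rmult_lt_0_compat => // |]; exact: exp_pos.
have XS : X <= exp (- s).
  apply: Rle_trans exp_small.
  have e1 : INR n / INR a.+1 <= A * exp Lam.
    apply: (Rmult_le_reg_r (INR a.+1)) => //.
    have -> : INR n / INR a.+1 * INR a.+1 = INR n by field; lra.
    have : 1 <= ell * (A * p) by nra.
    have : ell * (A * p) <= INR a.+1 * (A * p) by apply: Rmult_le_compat_r; rewrite ?S_INR; nra.
    rewrite exp_Lam => q1 q2; nra.
  have e2 : exp (- (beta * INR a / 2)) <= exp (- ((1 + g) * Lam)).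
    apply: exp_le; have : beta * ((1 + g) * ell) <= beta * INR a by apply: Rmult_le_compat_l; lra.
    have -> : beta * ((1 + g) * ell) = 2 * ((1 + g) * Lam) by rewrite /ell; field; lra.
    lra.
  have e3 := exp_le_3.
  apply: (Rle_trans _ (3 * (A * exp Lam) * exp (- ((1 + g) * Lam)))).
    apply: Rmult_le_compat => //; last 1 first.
    - by apply: Rmult_le_compat => //; [exact/Rlt_le/exp_pos | lra].
    - by apply: Rmult_le_pos; [exact/Rlt_le/exp_pos | lra].
    - exact/Rlt_le/exp_pos.
  have -> : 3 * (A * exp Lam) * exp (- ((1 + g) * Lam)) = 3 * A * exp (- (g * Lam)).
    rewrite (_ : 3 * (A * exp Lam) * _ = 3 * A * (exp Lam * exp (- ((1 + g) * Lam)))); last by ring.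
    by rewrite -exp_plus; congr (_ * exp _); ring.
  apply: Rmult_le_compat_l; first lra.
  by apply: exp_le; nra.
have X1 : X <= 1.
  by apply: Rle_trans XS _; rewrite -exp_0; apply: exp_le; lra.
apply: (Rle_trans _ (X ^ a.+1)); last first.
  apply: Rle_trans XS; rewrite /= -[X in _ <= X]Rmult_1_r; apply: Rmult_le_compat_l; first lra.
  by rewrite -[X in _ <= X](pow1 a); apply: pow_incr; lra.
have qE : (1 - p) ^ 'C(a.+1, 2) = exp (- (beta * INR a / 2)) ^ a.+1.
  by rewrite -exp_beta !exp_pow INR_bin2 !S_INR; congr exp; field.
rewrite qE /X [X in _ <= X]Rpow_mult_distr; apply: Rmult_le_compat_r.
  exact/pow_le/Rlt_le/exp_pos.
have x0 : 0 <= INR a.+1 / INR n by apply/Rlt_le/Rdiv_lt_0_compat.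
have := bin_exp_le n a.+1 x0.
have -> : INR n * (INR a.+1 / INR n) = INR a.+1 * 1 by field; lra.
rewrite -exp_pow => e4; rewrite Rpow_mult_distr.
have xp : 0 < (INR a.+1 / INR n) ^ a.+1 by apply/pow_lt/Rdiv_lt_0_compat.
apply: (Rmult_le_reg_r ((INR a.+1 / INR n) ^ a.+1)) => //.
rewrite Rmult_assoc -Rpow_mult_distr (_ : INR n / INR a.+1 * (INR a.+1 / INR n) = 1); last first.
  by field; lra.
by rewrite pow1 Rmult_1_r.
Qed.

Lemma s_ge64 : 64 <= s.
Proof.
have : 64 <= 64 * A / g.
  apply: (Rmult_le_reg_r g); first lra.
  have -> : 64 * A / g * g = 64 * A by field; lra.
  lra.
lra.
Qed.

Lemma dense_bound : exp (INR n * exp (- (p * INR m))) - 1 <= 2 * exp (- s).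
Proof.
have n0 := n_gt0; have m0 := m_gt0; have s64 := s_ge64.
have pm : 2 * (s * s) <= p * INR m.
  have e1 := np_pow_ge (k := 1) isT; rewrite pow_1 in e1.
  have e2 : s ^ 18 <= 2 * s ^ 3 * (p * INR m).
    have : INR n * p <= 2 * s ^ 3 * INR m * p by apply: Rmult_le_compat_r; lra.
    lra.
  have s3 := pow_s_ge1 3.
  apply: (Rmult_le_reg_l (2 * s ^ 3)); first lra.
  apply: Rle_trans e2.
  have -> : 2 * s ^ 3 * (2 * (s * s)) = 4 * s ^ 5 by ring.
  have -> : s ^ 18 = s * s ^ 12 * s ^ 5 by ring.
  apply: Rmult_le_compat_r; first by have := pow_s_ge1 5; lra.
  have := pow_s_ge1 12; nra.
set y := INR n * exp (- (p * INR m)).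
have y0 : 0 < y by apply: Rmult_lt_0_compat => //; exact: exp_pos.
have yS : y <= exp (- s) by rewrite /y nE -exp_plus; apply: exp_le; nra.
have es : exp (- s) <= 1 / 2.
  have := exp_ineq1_le s => h1.
  have h2 : exp s * exp (- s) = 1 by rewrite -exp_plus Rplus_opp_r exp_0.
  have := exp_pos (- s); nra.
have h1 := exp_ineq1_le (- y).
have h2 : exp y * exp (- y) = 1 by rewrite -exp_plus Rplus_opp_r exp_0.
have h3 := exp_pos y.
have h4 : exp y * (1 - y) <= 1 by rewrite -h2; apply: Rmult_le_compat_l; lra.
have h5 : exp y <= 2 by nra.
have : y * exp y <= y * 2 by apply: Rmult_le_compat_l; lra.
lra.
Qed.

(** Removed sets contribute [n a / k], and [a / k <= (1 + 2 g) / (1 - 2 g) <= 1 + 8 g], the last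
    step by [g <= 1/4]. The leftover colours times [a] cost at most [(24 + 16 t) n / s], which is at
    most [g n]. *)
Lemma colors_bound :
  let N := (n %/ k + (d + t * a).+1)%N in
  INR N * INR a <= INR n * (1 + 9 * g) /\ (N <= n)%N.
Proof.
move=> N; have n0 := n_gt0; have m0 := m_gt0; have s64 := s_ge64.
have [[a1 a2] a3] := a_bounds; have [[k1 k2] k3] := k_bounds; have [gl ell0] := ell_ge.
have k0 : 0 < INR k by lra.
have NE : INR N = INR (n %/ k) + (INR d + INR t * INR a + 1).
  by rewrite /N plus_INR S_INR plus_INR mult_INR.
have e1 : INR (n %/ k) * INR a <= INR n * (1 + 8 * g).
  have ak : INR a <= (1 + 8 * g) * INR k.
    have q1 : INR a <= (1 + 2 * g) * ell by lra.
    have q2 : (1 - 2 * g) * ell <= INR k by lra.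
    have q3 : (1 + 8 * g) * ((1 - 2 * g) * ell) <= (1 + 8 * g) * INR k by apply: Rmult_le_compat_l; lra.
    have q4 : (1 + 2 * g) * ell <= (1 + 8 * g) * (1 - 2 * g) * ell by apply: Rmult_le_compat_r; nra.
    lra.
  have nk : INR (n %/ k) * INR k <= INR n by rewrite -mult_INR; apply/le_INR/leP/leq_trunc_div.
  apply: (Rle_trans _ (INR (n %/ k) * ((1 + 8 * g) * INR k))).
    by apply: Rmult_le_compat_l => //; exact: pos_INR.
  nra.
have e2 : 4 * p * INR m * INR a * s <= 16 * INR n.
  have : INR m * s * (INR a * p) <= INR m * s * (4 * (s * s)) by apply: Rmult_le_compat_l; nra.
  have -> : INR m * s * (4 * (s * s)) = 4 * (INR m * s ^ 3) by ring.
  lra.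
have e3 : 2 * INR a * s <= 8 * INR n.
  apply: (Rmult_le_reg_r p) => //.
  have := np_pow_ge (k := 1) isT; rewrite pow_1 => q.
  have : s * (INR a * p) <= s * (4 * (s * s)) by apply: Rmult_le_compat_l; lra.
  have : s ^ 3 * 1 <= s ^ 3 * s ^ 15.
    by apply: Rmult_le_compat_l; [have := pow_s_ge1 3; lra | exact: pow_s_ge1].
  have -> : s ^ 3 * s ^ 15 = s ^ 18 by ring.
  have -> : s * (4 * (s * s)) = 4 * s ^ 3 by ring.
  lra.
have e4 : INR t * INR a * INR a * s <= 16 * INR t * INR n.
  have p2 : 0 < p ^ 2 by exact: pow_lt.
  apply: (Rmult_le_reg_r (p ^ 2)) => //.
  have ap0 : 0 <= INR a * p by apply: Rmult_le_pos; [exact: pos_INR | lra].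
  have : (INR a * p) ^ 2 <= (4 * (s * s)) ^ 2 by apply: pow_incr; lra.
  have -> : (4 * (s * s)) ^ 2 = 16 * s ^ 4 by ring.
  move=> q1.
  have q2 : INR t * s * (INR a * p) ^ 2 <= INR t * s * (16 * s ^ 4) by apply: Rmult_le_compat_l; nra.
  have q3 : s ^ 5 * 1 <= s ^ 5 * s ^ 13.
    by apply: Rmult_le_compat_l; [have := pow_s_ge1 5; lra | exact: pow_s_ge1].
  have q4 := np_pow_ge (k := 2) isT.
  have q5 : 16 * INR t * s ^ 5 <= 16 * INR t * (INR n * p ^ 2).
    by apply: Rmult_le_compat_l; [lra | apply: Rle_trans q4; rewrite (_ : s ^ 18 = s ^ 5 * s ^ 13); [lra | ring]].
  have -> : INR t * INR a * INR a * s * p ^ 2 = INR t * s * (INR a * p) ^ 2 by ring.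
  apply: (Rle_trans _ _ _ q2).
  have -> : INR t * s * (16 * s ^ 4) = 16 * INR t * s ^ 5 by ring.
  by rewrite (_ : 16 * INR t * INR n * p ^ 2 = 16 * INR t * (INR n * p ^ 2)); last ring.
have e5 : (INR d + INR t * INR a + 1) * INR a <= INR n * g.
  apply: (Rmult_le_reg_r s); first lra.
  have q1 : INR d * (INR a * s) <= (4 * p * INR m + 1) * (INR a * s) by apply: Rmult_le_compat_r; nra.
  have q2 : (24 + 16 * INR t) * INR n <= s * g * INR n by apply: Rmult_le_compat_r; lra.
  lra.
have Na : INR N * INR a <= INR n * (1 + 9 * g) by rewrite NE; lra.
split=> //; apply/leP/INR_le.
have q1 : INR N * 4 <= INR N * INR a by apply: Rmult_le_compat_l; [exact: pos_INR | lra].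
have : INR n * (1 + 9 * g) <= INR n * 4 by apply: Rmult_le_compat_l; lra.
lra.
Qed.

End ChosenSizes.

Lemma parameters_exist : exists k a m d : nat,
  [/\ (1 - g) * ell - 1 <= INR k <= (1 - g) * ell,
      (1 + g) * ell <= INR a <= (1 + g) * ell + 1,
      INR n <= 2 * s ^ 3 * INR m, INR m * s ^ 3 <= INR n &
      4 * p * INR m <= INR d <= 4 * p * INR m + 1].
Proof.
have [l1 _] := ell_bounds; have s64 := s_ge64.
have l0 : 0 < ell by apply: Rlt_le_trans l1; apply: Rdiv_lt_0_compat; lra.
have [k hk] : exists k, INR k <= (1 - g) * ell < INR k + 1 by apply: nat_floor; nra.
have [a ha] : exists a, INR a <= (1 + g) * ell < INR a + 1 by apply: nat_floor; nra.
have s3 := pow_s_ge1 3; have n0 := n_gt0.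
have [m hm] : exists m, INR m <= INR n / s ^ 3 < INR m + 1.
  by apply: nat_floor; apply/Rlt_le/Rdiv_lt_0_compat; lra.
have [d hd] : exists d, INR d <= 4 * p * INR m < INR d + 1.
  by apply: nat_floor; apply: Rmult_le_pos; [lra | exact: pos_INR].
have ns : INR n / s ^ 3 * s ^ 3 = INR n by field; lra.
(* [k] and [m] are rounded down, [a] and [d] up. As [n / s^3 >= 2], rounding [m] loses at most a
   factor 2. *)
exists k, a.+1, m, d.+1; split; rewrite ?S_INR; try lra.
- have x2 : 2 <= INR n / s ^ 3.
    apply: (Rmult_le_reg_r (s ^ 3)); rewrite ?ns; first lra.
    have := np_pow_ge (k := 0) isT; rewrite /= Rmult_1_r.
    have : s ^ 3 * 2 <= s ^ 3 * s ^ 15.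
      apply: Rmult_le_compat_l; first lra.
      by rewrite (_ : s ^ 15 = s * s ^ 14); [have := pow_s_ge1 14; nra | ring].
    have -> : s ^ 3 * s ^ 15 = s ^ 18 by ring.
    rewrite /=; lra.
  have : INR n / s ^ 3 * s ^ 3 <= 2 * INR m * s ^ 3 by apply: Rmult_le_compat_r; lra.
  rewrite ns; lra.
- have : INR m * s ^ 3 <= INR n / s ^ 3 * s ^ 3 by apply: Rmult_le_compat_r; lra.
  rewrite ns; lra.
Qed.

(** * From the failure events to the statement with high probability *)

Lemma Pr_gnpE (E : {set 'I_n * 'I_n} -> Prop) :
  Pr_gnp p E = Ex p (upairs n) (fun S => indic (event_ind E S)).
Proof.
have foldrE (r : seq {set 'I_n * 'I_n}) :
    foldr (fun S acc => gnp_weight p S + acc) 0 r = \big[Rplus/0]_(S <- r) gnp_weight p S.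
  by elim: r => [|S r IH]; rewrite ?big_nil ?big_cons //= IH.
rewrite /Pr_gnp foldrE big_filter big_enum_cond /= /Ex big_mkcond [in RHS]big_mkcond.
apply: eq_bigr => S _; rewrite -/(is_graph S) /gnp_weight.
by case: (is_graph S); case: (event_ind E S); rewrite /indic /=; ring.
Qed.

Lemma whp_bound (delta : R) : 9 * g * INR t <= delta ->
  1 - 4 * exp (- s) <= Pr_gnp p (fun S : {set 'I_n * 'I_n} =>
    Rabs (INR (tau t S) - INR t * INR (chi S)) <= delta * INR (chi S)).
Proof.
move=> hdelta; have [k [a [m [d [Hk Ha Hm Hm' Hd]]]]] := parameters_exist.
have p01 : 0 <= p < 1 by lra.
set E := fun S => _.
have B1 := Rle_trans _ _ _ (Pr_large_indep n p01 a.+1) (large_indep_bound Ha Hd).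
have B2 := Rle_trans _ _ _ (Pr_stuck n p01 (k_gt1 Hk Hd) (k_le_m Hk Ha Hm Hd)
  (conflict_bound Hk Ha Hm Hd) (janson_sum Hk Ha Hm Hm' Hd)) (stuck_bound Hk Hm Hd).
have B3 := Rle_trans _ _ _ (Pr_dense_spot n p01 (proj1 Hd)) (dense_bound Hk Hm Hd).
have [Na Nn] := colors_bound Hk Ha Hm Hm' Hd.
set N := (n %/ k + _)%N in Na Nn.
set b1 := (fun S => _) in B1; set b2 := (fun S => _) in B2; set b3 := (fun S => _) in B3.
rewrite Pr_gnpE.
(* Pointwise, [E] or one of the three failures holds; their probabilities are at most [exp (- s)],
   [exp (- s)] and [2 * exp (- s)]. *)
suff : Ex p (upairs n) (fun=> 1) <=
    Ex p (upairs n) (fun S => indic (event_ind E S) + (b1 S + (b2 S + b3 S))).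
  by rewrite Ex1 // !ExD; lra.
apply: Ex_le => // S sS; rewrite /b1 /b2 /b3.
case q1: [exists I : {set 'I_n}, (#|I| == a.+1) && indep S I].
  have := indic_ge0 (event_ind E S); have := indic_ge0 (stuck t k m a S).
  have := indic_ge0 (dense_spot m d S); rewrite /(indic true); lra.
case q2: (stuck t k m a S).
  have := indic_ge0 (event_ind E S); have := indic_ge0 (dense_spot m d S).
  rewrite /(indic true) /(indic false); lra.
case q3: (dense_spot m d S).
  have := indic_ge0 (event_ind E S); rewrite /(indic true) /(indic false); lra.
have indep_le A0 : indep S A0 -> (#|A0| <= a)%N.
  move=> iA; rewrite leqNgt; apply/negP=> /subset_of_card[B sB cB].
  have /negP := negbT q1; apply; apply/existsP; exists B; rewrite cB eqxx /=.
  apply: disjointWr iA; apply/subsetP=> e; rewrite !inE => /andP[-> /andP[e1 e2]].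
  by rewrite !(subsetP sB).
have [X1 X2 X3 X4] := chi_tau_bounds sS indep_le t_gt0 (ltnW (k_gt1 Hk Hd))
  (negbT q2) (negbT q3) Nn.
suff ES : E S.
  have -> : event_ind E S by rewrite /event_ind; case: ClassicalEpsilon.excluded_middle_informative.
  rewrite /indic; lra.
have a0 : 0 < INR a by apply/lt_0_INR/ltP/(a_gt0 Ha Hd).
move/leP/le_INR: X1; move/leP/le_INR: X2; move/leP/le_INR: X3; move/leP/le_INR: X4.
rewrite !mult_INR -/N => Y4 Y3 Y2 Y1.
(* Multiplied by [a], both [tau] and [t * chi] lie between [t n] and [t a N]. This gap is at most
   [9 g t n], hence at most [delta n], and [n <= a * chi]. *)
have Z0 : INR t * (INR a * INR N) - INR t * INR n <= delta * INR n.
  have : INR t * (INR N * INR a) <= INR t * (INR n * (1 + 9 * g)) by apply: Rmult_le_compat_l; lra.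
  have : 9 * g * INR t * INR n <= delta * INR n by apply: Rmult_le_compat_r; [exact: pos_INR | ].
  lra.
have D0 : 0 <= delta by nra.
have Z1 : delta * INR n <= delta * (INR a * INR (chi S)) by apply: Rmult_le_compat_l.
have Z2 : INR a * INR (tau t S) <= INR a * (INR t * INR N) by apply: Rmult_le_compat_l; lra.
have Z3 : INR t * INR n <= INR t * (INR a * INR (chi S)) by apply: Rmult_le_compat_l; lra.
have Z4 : INR t * INR a * INR (chi S) <= INR t * INR a * INR N by apply: Rmult_le_compat_l; nra.
rewrite /E; apply: Rabs_le; split; apply: (Rmult_le_reg_l (INR a)) => //; lra.
Qed.

End Asymptotics.

Lemma Rpower_lower_bound (n : nat) (C p : R) : 1 <= C -> (1 < n)%N ->
  C * Rpower (INR n) (-1/4) * Rpower (ln (INR n)) (9/4) <= p ->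
  sqrt (ln (INR n)) ^ 18 <= INR n * p ^ 4.
Proof.
move=> C1 n1 hp.
have n0 : 1 < INR n by apply: (lt_INR 1); apply/ltP.
have L0 : 0 < ln (INR n) by rewrite -ln_1; apply: ln_increasing; lra.
set x := Rpower (INR n) (-1/4) in hp; set y := Rpower (ln (INR n)) (9/4) in hp.
have x0 : 0 < x by apply: exp_pos.
have y0 : 0 < y by apply: exp_pos.
have xyp : x * y <= p by apply: Rle_trans hp; rewrite Rmult_assoc -{1}(Rmult_1_l (x * y)); apply: Rmult_le_compat_r; nra.
have : (x * y) ^ 4 <= p ^ 4 by apply: pow_incr; nra.
rewrite Rpow_mult_distr => h.
have xE : INR n * x ^ 4 = 1.
  rewrite /x /Rpower exp_pow -{1}(exp_ln (INR n)); last lra.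
  by rewrite -exp_plus -exp_0; congr exp; rewrite [INR 4]/=; field.
have yE : y ^ 4 = ln (INR n) ^ 9.
  rewrite -[X in _ = X ^ 9](exp_ln _ L0) /y /Rpower !exp_pow; congr exp.
  by rewrite [INR 4]/= [INR 9]/=; field.
have -> : sqrt (ln (INR n)) ^ 18 = ln (INR n) ^ 9.
  by rewrite (pow_mult _ 2 9) pow2_sqrt //; lra.
rewrite -yE -[X in X <= _]Rmult_1_l -xE Rmult_assoc; apply: Rmult_le_compat_l => //; lra.
Qed.

(* tau_t(G_{n,p}) = (t + o(1)) chi(G_{n,p}) whp, read as: for every delta > 0,
   whp |tau_t(G) - t chi(G)| <= delta chi(G). *)
Theorem theorem3 :
  forall (t : nat), (3 <= t)%nat ->
  forall eps : R, eps < 1 ->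
  exists C0 : R, forall C : R, C0 <= C ->
  forall p : nat -> R,
    (exists N : nat, forall n : nat, (N <= n)%nat ->
       C * Rpower (INR n) (-1/4) * Rpower (ln (INR n)) (9/4) <= p n /\ p n < eps) ->
  forall delta : R, 0 < delta ->
    whp p (fun n S =>
      Rabs (INR (tau t S) - INR t * INR (chi S)) <= delta * INR (chi S)).
Proof.
move=> t t3 eps eps1; exists 1 => C C1 p [N1 hp] delta delta0 eta eta0.
have t1 : 1 <= INR t by apply: (le_INR 1); apply/leP/(leq_trans _ t3).
(* The maximum with 0 gives [1 <= A] whatever the sign of [eps]. *)
pose A := / (1 - Rmax 0 eps).
have e1 : 0 <= Rmax 0 eps < 1 by split; [apply: Rmax_l | apply: Rmax_lub_lt; lra].
have A1 : 1 <= A by rewrite /A -[X in X <= _]Rinv_1; apply: Rinv_le_contravar; lra.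
pose g := Rmin (/ 4) (delta / (9 * INR t)).
have g0 : 0 < g <= / 4.
  split; last exact: Rmin_l.
  by apply: Rmin_glb_lt; [lra | apply: Rdiv_lt_0_compat; lra].
have g3 : 0 < g ^ 3 by apply: pow_lt; lra.
have hdelta : 9 * g * INR t <= delta.
  have : g * (9 * INR t) <= delta / (9 * INR t) * (9 * INR t).
    by apply: Rmult_le_compat_r; [lra | exact: Rmin_r].
  by rewrite (_ : delta / (9 * INR t) * (9 * INR t) = delta); [lra | field; lra].
(* The sum of all lower bounds required of [s], with [4 / eta] added to make [4 * exp (- s) <= eta];
   [n >= exp (M^2)] then ensures [s >= M]. *)
pose M := 1 + 64 * A / g + 4096 * A * (INR t + 2) + (64 * INR t + 24 + 16 * INR t) / g
  + 221184 / g ^ 3 + 4 / eta.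
have M1 : 0 <= 64 * A / g by apply/Rlt_le/Rdiv_lt_0_compat; lra.
have M2 : 0 <= 4096 * A * (INR t + 2) by nra.
have M3 : 0 <= (64 * INR t + 24 + 16 * INR t) / g by apply/Rlt_le/Rdiv_lt_0_compat; lra.
have M4 : 0 <= 221184 / g ^ 3 by apply/Rlt_le/Rdiv_lt_0_compat; lra.
have M5 : 0 <= 4 / eta by apply/Rlt_le/Rdiv_lt_0_compat; lra.
have [N2 [_ N2M]] := nat_floor (Rlt_le _ _ (exp_pos (M * M))).
exists (maxn N1 (maxn N2.+1 2)) => n; rewrite !geq_max => /and3P[nN1 nN2 n2].
have [hpn pe] := hp n nN1.
have n1 : 1 < INR n by apply: (lt_INR 1); apply/ltP.
have nM : exp (M * M) <= INR n.
  by move/leP/le_INR: nN2; rewrite S_INR; lra.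
set s := sqrt (ln (INR n)).
have LM : M * M <= ln (INR n) by rewrite -(ln_exp (M * M)); apply: ln_le nM; exact: exp_pos.
have ss : s * s = ln (INR n) by apply: sqrt_sqrt; nra.
have sM : M <= s by rewrite -(sqrt_square M); [apply: sqrt_le_1_alt | rewrite /M; lra].
have pn0 : 0 < p n.
  apply: Rlt_le_trans hpn; apply: Rmult_lt_0_compat; last exact: exp_pos.
  by apply: Rmult_lt_0_compat; [lra | exact: exp_pos].
have peA : / A <= 1 - p n.
  by rewrite /A Rinv_inv; have := Rmax_r 0 eps; lra.
have gM x : x / g <= s -> x <= s * g.
  by move=> h; have := Rmult_le_compat_r g _ _ ltac:(lra) h;
     rewrite (_ : x / g * g = x); [| field; lra].
have es : 4 * exp (- s) <= eta.
  have h1 : exp s * exp (- s) = 1 by rewrite -exp_plus Rplus_opp_r exp_0.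
  have h2 := exp_ineq1_le s; have h3 := exp_pos (- s).
  have h4 : 4 / eta * exp (- s) <= 1 by rewrite -h1; apply: Rmult_le_compat_r; rewrite /M in sM; lra.
  have := Rmult_le_compat_l eta _ _ ltac:(lra) h4.
  by rewrite -Rmult_assoc (_ : eta * (4 / eta) = 4); [lra | field; lra].
apply: Rle_trans (@whp_bound n t (p n) A g s _ _ _ _ _ _ _ _ _ _ _ _ _ delta _) => //.
- lra.
- by rewrite /M in sM; lra.
- by rewrite ss exp_ln //; lra.
- by have := Rmax_r 0 eps; lra.
- exact: Rpower_lower_bound C1 n2 hpn.
- by rewrite /M in sM; lra.
- by rewrite /M in sM; lra.
- by apply: gM; rewrite /M in sM; lra.
have := Rmult_le_compat_r (g ^ 3) (221184 / g ^ 3) s ltac:(lra) ltac:(rewrite /M in sM; lra).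
by rewrite (_ : 221184 / g ^ 3 * g ^ 3 = 221184); [| field; lra].
Qed.
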